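(* If $\nu$ is an ergodic invariant random subgroup of $\mathrm{Fin}(\mathbb{N})$, then there exist $\alpha = (\alpha_i)_{i \in \mathbb{N}^+} \in D[0,1]$ with $\sum_{i=1}^{\infty} \alpha_i \leq 1$ and a subgroup $A \leqslant S_\alpha$ such that $\nu = \nu^{A}_{\alpha}$.
   Context: $\mathbb{N} = \{0,1,2,\dots\}$ and $\mathbb{N}^+ = \{1,2,\dots\}$; each $n \in \mathbb{N}$ is identified with $\{0,1,\dots,n-1\}$. For an infinite set $\Omega$, $\mathrm{Fin}(\Omega)$ is the group of permutations $g$ of $\Omega$ with $\mathrm{supp}(g)=\{\omega \in \Omega \mid g(\omega)\neq\omega\}$ finite; $\mathrm{sgn}(\pi)\in\{\pm1\}$ is the sign of a finitary permutation $\pi$. For a countably infinite group $G$, $\mathrm{Sub}_G$ is the compact space of subgroups of $G$ (a closed subspace of $2^G$), on which $G$ acts by conjugation. An invariant random subgroup (IRS) of $G$ is a Borel probability measure $\nu$ on $\mathrm{Sub}_G$ which is invariant under this conjugation action; it is ergodic if every $G$-invariant Borel set has $\nu$-measure $0$ or $1$. $D[0,1]$ is the set of sequences $\alpha=(\alpha_1,\alpha_2,\dots)\in[0,1]^{\mathbb{N}^+}$ with $\alpha_1\geq\alpha_2\geq\cdots$. Let $\alpha\in D[0,1]$ with $\sum_{i=1}^\infty\alpha_i\leq1$. Put $\alpha_0=1-\sum_{i=1}^\infty\alpha_i$, let $p_\alpha$ be the probability measure on $\mathbb{N}$ with $p_\alpha(\{i\})=\alpha_i$, and let $\mu_\alpha$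 be the corresponding product probability measure on $\mathbb{N}^{\mathbb{N}}$. $\mathrm{Fin}(\mathbb{N})$ acts on $(\mathbb{N}^{\mathbb{N}},\mu_\alpha)$ by $(g\cdot\xi)(n)=\xi(g^{-1}(n))$. For $\xi\in\mathbb{N}^{\mathbb{N}}$ and $i\in\mathbb{N}$ let $B_i^\xi=\{n\in\mathbb{N}\mid\xi(n)=i\}$. Call $\xi$ $\mu_\alpha$-generic if for all $i\in\mathbb{N}$ the following are equivalent: (a) $\alpha_i>0$; (b) $B_i^\xi\neq\emptyset$; (c) $B_i^\xi$ is infinite; (d) $\lim_{n\to\infty}|B_i^\xi\cap\{0,\dots,n-1\}|/n=\alpha_i>0$. ($\mu_\alpha$-a.e. $\xi$ is $\mu_\alpha$-generic.) Let $I=\{i\in\mathbb{N}^+\mid\alpha_i>0\}$. If $\alpha_0\neq1$ (so $I\neq\emptyset$), let $S_\alpha=\bigoplus_{i\in I}C_i$ be the restricted direct product of the multiplicative groups $C_i=\{\pm1\}$. For each subgroup $A\leqslant S_\alpha$ define $f_\alpha^A:\mathbb{N}^{\mathbb{N}}\to\mathrm{Sub}_{\mathrm{Fin}(\mathbb{N})}$, $\xi\mapsto H_\xi$, as follows: if $\xi$ is $\mu_\alpha$-generic then $H_\xi=s_\xi^{-1}(A)$, where $s_\xi:\bigoplus_{i\in I}\mathrm{Fin}(B_i^\xi)\to\bigoplus_{i\in I}C_i$ is the homomorphism $(\pi_i)\mapsto(\mathrm{sgn}(\pi_i))$ and $\bigoplus_{i\in I}\mathrm{Fin}(B_i^\xi)$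 is regarded as a subgroup of $\mathrm{Fin}(\mathbb{N})$ in the obvious way (fixing every point outside $\bigcup_{i\in I}B_i^\xi$); otherwise $H_\xi=1$. Let $\nu_\alpha^A=(f_\alpha^A)_*\mu_\alpha$, which is an ergodic IRS of $\mathrm{Fin}(\mathbb{N})$. If $\alpha_0=1$, then $S_\alpha=1$ is the trivial group and $\nu_\alpha^{S_\alpha}=\delta_1$, the point mass at the trivial subgroup. *)

(* Defs.v *)
From HB Require Import structures.
From mathcomp Require Import all_boot all_order all_algebra all_fingroup.
From mathcomp Require Import all_classical all_reals all_analysis.
From mathcomp Require Import measurable_realfun.

Set Implicit Arguments.
Unset Strict Implicit.
Unset Printing Implicit Defensive.

Import Order.TTheory GRing.Theory Num.Theory.
Import numFieldNormedType.Exports.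

Local Open Scope classical_set_scope.
Local Open Scope ring_scope.

Section Subgroups.
Variable G : groupType.

(* Sub_G, as a subspace of 2^G with the product topology; subgroups are given
   by their indicator functions. *)
Definition subgroup_set : set (prod_topology (fun _ : G => bool)) :=
  [set H | group_closed (H : {pred G})].

Definition Sub : Type := set_type subgroup_set.

HB.instance Definition _ := Topological.copy Sub (set_type subgroup_set).

Lemma subgroup_trivial : subgroup_set (fun g : G => g == 1%g).
Proof.
split; first by rewrite unfold_in.
by move=> x y; rewrite !unfold_in => /eqP-> /eqP->; rewrite mul1g invg1.
Qed.

Definition mkSub (H : G -> bool) (sH : subgroup_set H) : Sub :=
  exist _ (H : prod_topology (fun _ : G => bool)) (mem_set sH).

Definition trivial_subgroup : Sub := mkSub subgroup_trivial.

HB.instance Definition _ := isPointed.Build Sub trivial_subgroup.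

Definition BorelSub := g_sigma_algebraType (@open Sub).

Lemma subgroup_conj (g : G) (H : Sub) :
  subgroup_set (fun x : G => val H (x ^ g)%g).
Proof.
case: H => H /= /set_mem [H1 HD]; split; first by rewrite unfold_in conj1g.
move=> x y; rewrite !unfold_in => Hx Hy.
by rewrite conjMg conjVg; exact: HD.
Qed.

(* The conjugate g H g^-1; recall that x ^ g is g^-1 x g. *)
Definition conj_subgroup (g : G) (H : BorelSub) : BorelSub :=
  mkSub (subgroup_conj g H).

Definition is_IRS (R : realType) (nu : probability BorelSub R) : Prop :=
  forall (g : G) (E : set BorelSub), measurable E ->
    nu (conj_subgroup g @^-1` E) = nu E.

Definition is_ergodic (R : realType) (nu : probability BorelSub R) : Prop :=
  forall E : set BorelSub, measurable E ->
    (forall g : G, conj_subgroup g @^-1` E = E) ->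
    nu E = 0%E \/ nu E = 1%E.

End Subgroups.

Record FinN := mkFinN {
  FinN_fun :> nat -> nat;
  FinN_bij : bijective FinN_fun;
  FinN_supp : finite_set [set n | FinN_fun n <> n] }.

Lemma FinN_ext (g h : FinN) : g =1 h -> g = h.
Proof.
case: g h => [g gb gs] [h hb hs] /= /funext gh; subst h.
by congr mkFinN; exact: Prop_irrelevance.
Qed.

HB.instance Definition _ := gen_eqMixin FinN.
HB.instance Definition _ := gen_choiceMixin FinN.

Section FinNGroup.

Definition FinN_one : FinN.
Proof.
by exists id; [exists id | rewrite [X in finite_set X](_ : _ = set0) // -subset0].
Defined.

Definition FinN_mul (g h : FinN) : FinN.
Proof.
exists (g \o h); first by apply: bij_comp; exact: FinN_bij.
apply: (@sub_finite_set _ _ ([set n | g n <> n] `|` [set n | h n <> n])).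
  move=> n /=; have [->|] := pselect (h n = n); first by left.
  by right.
by rewrite finite_setU; split; exact: FinN_supp.
Defined.

Lemma FinN_has_inv (g : FinN) : {h : nat -> nat | cancel g h & cancel h g}.
Proof. by apply: cid2; case: (FinN_bij g) => h gK hK; exists h. Qed.

Definition FinN_inv (g : FinN) : FinN.
Proof.
exists (s2val (FinN_has_inv g)).
  by case: FinN_has_inv => h gK hK; exists g.
apply: sub_finite_set (FinN_supp g) => n /=.
case: FinN_has_inv => h gK hK /= hn gn; apply: hn.
by rewrite -[RHS]gK gn.
Defined.

Lemma FinN_mulA : associative FinN_mul.
Proof. by move=> g h k; exact: FinN_ext. Qed.
Lemma FinN_mul1 : left_id FinN_one FinN_mul.
Proof. by move=> g; exact: FinN_ext. Qed.
Lemma FinN_mulr1 : right_id FinN_one FinN_mul.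
Proof. by move=> g; exact: FinN_ext. Qed.
Lemma FinN_mulV : left_inverse FinN_one FinN_inv FinN_mul.
Proof.
by move=> g; apply: FinN_ext => n /=; case: FinN_has_inv => h gK hK /=.
Qed.
Lemma FinN_mulrV : right_inverse FinN_one FinN_inv FinN_mul.
Proof.
by move=> g; apply: FinN_ext => n /=; case: FinN_has_inv => h gK hK /=.
Qed.

End FinNGroup.

HB.instance Definition _ := isGroup.Build FinN FinN_mulA FinN_mul1 FinN_mulr1
  FinN_mulV FinN_mulrV.

Lemma FinN_mulE (g h : FinN) n : (g * h)%g n = g (h n).
Proof. by []. Qed.

Lemma FinN_mulgV (g : FinN) n : g (g^-1%g n) = n.
Proof. by rewrite -FinN_mulE mulgV. Qed.

Section Sign.

Definition fixes_above (g : FinN) (n : nat) := forall m, (n <= m)%N -> g m = m.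

Lemma FinN_bound (g : FinN) : {n | fixes_above g n}.
Proof.
apply: cid; have /finite_seqP[s sE] := FinN_supp g.
exists (\max_(k <- s) k).+1 => m sm; apply: contrapT => gm.
have : [set n | g n <> n] m by [].
rewrite sE /= => ms; move: sm; rewrite ltnNge.
by rewrite (big_rem m) //= leq_maxl.
Qed.

Lemma FinN_inj (g : FinN) : injective g.
Proof. exact/bij_inj/FinN_bij. Qed.

Lemma fixes_above_lt (g : FinN) n : fixes_above g n ->
  forall i, (i < n)%N -> (g i < n)%N.
Proof.
move=> gn i lt_in; rewrite ltnNge; apply/negP => n_gi.
have /FinN_inj gi := gn _ n_gi.
by move: n_gi; rewrite gi leqNgt lt_in.
Qed.

Definition ord_restr (g : FinN) n (i : 'I_n) : 'I_n := insubd i (g i).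

Lemma ord_restrE g n (gn : fixes_above g n) (i : 'I_n) : ord_restr g i = g i :> nat.
Proof. by rewrite val_insubd fixes_above_lt. Qed.

Lemma ord_restr_inj g n (gn : fixes_above g n) : injective (@ord_restr g n).
Proof.
move=> i j /(congr1 (@nat_of_ord n)); rewrite !ord_restrE // => /FinN_inj.
exact: val_inj.
Qed.

Definition restr_perm g n (gn : fixes_above g n) : {perm 'I_n} :=
  perm (ord_restr_inj gn).

(* The sign of g, computed in the symmetric group on {0, ..., n-1} for some n
   with supp g contained in {0, ..., n-1}; by [FinN_sgnE] any such n will do. *)
Definition FinN_sgn (g : FinN) : int :=
  (-1) ^+ restr_perm (svalP (FinN_bound g)).

Lemma fixes_above_leq (g : FinN) m n :
  (m <= n)%N -> fixes_above g m -> fixes_above g n.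
Proof. by move=> mn gm k /(leq_trans mn); exact: gm. Qed.

Lemma restr_permS (g : FinN) n (gn : fixes_above g n)
    (gn1 : fixes_above g n.+1) : restr_perm gn1 = restr_perm gn :> bool.
Proof.
have -> : restr_perm gn1 = lift_perm ord_max ord_max (restr_perm gn).
  apply/permP => i; apply: val_inj; rewrite permE [LHS]ord_restrE//.
  case: (unliftP ord_max i) => [j|] ->.
    rewrite lift_perm_lift permE /= /bump leqNgt ltn_ord add0n.
    by rewrite ord_restrE // leqNgt fixes_above_lt.
  by rewrite lift_perm_id /= gn.
by rewrite odd_lift_perm addbb.
Qed.

Lemma restr_perm_leq (g : FinN) m n (gm : fixes_above g m)
    (gn : fixes_above g n) : (m <= n)%N ->
  restr_perm gn = restr_perm gm :> bool.
Proof.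
move=> /subnKC nE; move: gn; rewrite -{}nE; elim: (n - m)%N => [|k IHk].
  by rewrite addn0 => gm'; rewrite (Prop_irrelevance gm' gm).
rewrite addnS => gn; have gmk := fixes_above_leq (leq_addr k m) gm.
by rewrite (restr_permS gmk).
Qed.

Lemma FinN_sgnE (g : FinN) n (gn : fixes_above g n) :
  FinN_sgn g = (-1) ^+ restr_perm gn.
Proof.
rewrite /FinN_sgn; case: FinN_bound => m gm /=.
by congr (_ ^+ nat_of_bool _); case/orP: (leq_total m n) => ?;
  [symmetry|]; exact: restr_perm_leq.
Qed.

Lemma FinN_sgn1 : FinN_sgn 1%g = 1.
Proof.
have g0 : fixes_above 1%g 0 by [].
by rewrite (FinN_sgnE g0) (_ : restr_perm g0 = 1%g) ?odd_perm1//; apply/permP => -[].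
Qed.

Lemma FinN_sgnM (g h : FinN) : FinN_sgn (g * h)%g = FinN_sgn g * FinN_sgn h.
Proof.
have [m gm] := FinN_bound g; have [n hn] := FinN_bound h.
have gN := fixes_above_leq (leq_maxl m n) gm.
have hN := fixes_above_leq (leq_maxr m n) hn.
have ghN : fixes_above (g * h)%g (maxn m n).
  by move=> k Nk; rewrite FinN_mulE hN ?gN.
rewrite (FinN_sgnE gN) (FinN_sgnE hN) (FinN_sgnE ghN) mulrC -signr_addb.
rewrite -odd_permM; congr ((-1) ^+ nat_of_bool (odd_perm _)).
apply/permP => i; apply: val_inj.
by rewrite permM !permE /= !ord_restrE //= ord_restrE.
Qed.

Lemma FinN_sgn_pm1 (g : FinN) : FinN_sgn g = 1 \/ FinN_sgn g = -1.
Proof. by rewrite /FinN_sgn; case: odd_perm; [right|left]. Qed.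

Lemma FinN_sgnV (g : FinN) : FinN_sgn (g^-1)%g = (FinN_sgn g)^-1.
Proof.
have := FinN_sgnM g g^-1%g; rewrite mulgV FinN_sgn1.
by case: (FinN_sgn_pm1 g) => ->; case: (FinN_sgn_pm1 g^-1%g) => ->.
Qed.

End Sign.

(* The restricted direct product over I of the groups {1, -1}, as functions on
   nat equal to 1 outside a finite subset of I. *)
Definition sign_sum (I : set nat) : set (nat -> int) :=
  [set e | [/\ forall i, e i = 1 \/ e i = -1,
               forall i, ~ I i -> e i = 1 &
               finite_set [set i | e i <> 1]]].

Record sign_subgroup (I : set nat) := SignSubgroup {
  sign_carrier : set (nat -> int);
  sign_subset : sign_carrier `<=` sign_sum I;
  sign_one : sign_carrier (fun _ => 1);
  sign_mul : forall e f, sign_carrier e -> sign_carrier f ->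
    sign_carrier (fun i => e i * f i);
  sign_inv : forall e, sign_carrier e -> sign_carrier (fun i => (e i)^-1) }.

Section Hxi.
Variable I : set nat.
Implicit Types (xi : nat -> nat) (tau : nat -> FinN).

Definition block xi (i : nat) : set nat := [set n | xi n = i].

(* The restricted direct product over i in I of the groups Fin(B_i), an
   element of Fin(B_i) being extended by the identity to all of nat. *)
Definition block_sum xi : set (nat -> FinN) :=
  [set tau : nat -> FinN | [/\ forall i n, I i -> ~ block xi i n -> tau i n = n,
                forall i, ~ I i -> tau i = 1%g &
                finite_set [set i | tau i <> 1%g]]].

Definition sign_map tau : nat -> int := fun i => FinN_sgn (tau i).

(* g is the image in Fin(N) of the family tau: it agrees with tau_i on B_i. *)
Definition glues xi tau (g : FinN) : Prop := forall n, g n = tau (xi n) n.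

(* The preimage of A under the sign map, as a subset of Fin(N). *)
Definition sign_preimage (A : sign_subgroup I) xi (g : FinN) : bool :=
  `[< exists tau, [/\ block_sum xi tau, sign_carrier A (sign_map tau) & glues xi tau g] >].

Lemma block_sum_stable xi tau i n :
  block_sum xi tau -> xi n = i -> xi (tau i n) = i.
Proof.
move=> [piB pi1 _] ni; have [Ii|/pi1 ->] := pselect (I i); last exact: ni.
apply: contrapT => Bi; apply: (Bi); have /FinN_inj -> // := piB i _ Ii Bi.
Qed.

Lemma sign_preimage_group (A : sign_subgroup I) xi :
  subgroup_set (sign_preimage A xi).
Proof.
split.
  rewrite unfold_in; apply/asboolP; exists (fun=> 1%g); split=> //.
    split=> //; rewrite [X in finite_set X](_ : _ = set0) //.
    by rewrite -subset0 => i /=.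
  rewrite (_ : sign_map _ = fun=> 1); first exact: sign_one.
  by apply/funext => i; exact: FinN_sgn1.
move=> g h; rewrite !unfold_in => /asboolP[tau [piS Api gpi]].
move=> /asboolP[rho [rhoS Arho hrho]].
apply/asboolP; exists (fun i => tau i * (rho i)^-1)%g.
have rhoVS : block_sum xi (fun i => (rho i)^-1)%g.
  case: rhoS => rB r1 rf; split.
  - move=> i n Ii Bn; apply: (@FinN_inj (rho i)).
    by rewrite FinN_mulgV rB.
  - by move=> i /r1 ->; rewrite invg1.
  - by apply: sub_finite_set rf => i /= ri r1i; apply: ri; rewrite r1i invg1.
split.
- case: piS rhoVS => pB p1 pf [rB r1 rf]; split.
  + by move=> i n Ii Bn; rewrite FinN_mulE rB// pB.
  + by move=> i Ii; rewrite p1// r1// mulg1.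
  + apply: (@sub_finite_set _ _ ([set i | tau i <> 1%g] `|`
        [set i | (rho i)^-1%g <> 1%g])); last by rewrite finite_setU.
    move=> i /= pr; have [p1i|] := pselect (tau i = 1%g); last by left.
    by right=> ri; apply: pr; rewrite p1i ri mulg1.
- rewrite (_ : sign_map _ = fun i => sign_map tau i * (sign_map rho i)^-1).
    by apply: sign_mul => //; exact: (sign_inv Arho).
  by apply/funext => i; rewrite /sign_map FinN_sgnM FinN_sgnV.
- have hV n : h^-1%g n = (rho (xi n))^-1%g n.
    apply: (@FinN_inj h); rewrite FinN_mulgV hrho.
    by rewrite (block_sum_stable rhoVS)// FinN_mulgV.
  by move=> n; rewrite !FinN_mulE hV gpi (block_sum_stable rhoVS).
Qed.

End Hxi.

(* The product sigma-algebra, nat being discrete. *)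
Definition coordinate_sets : set (set (nat -> nat)) :=
  [set E | exists n (B : set nat), E = [set xi | B (xi n)]].

Definition seqNat := g_sigma_algebraType coordinate_sets.

Section ProductMeasure.
Variable R : realType.
Implicit Types w : nat -> R.

Definition cylinder (n : nat) (k : nat -> nat) : set seqNat :=
  [set xi | forall i, (i < n)%N -> xi i = k i].

(* mu is the product of countably many copies of the probability measure on nat
   with point masses w; as the cylinders form a pi-system generating the
   sigma-algebra of seqNat, at most one mu satisfies this. *)
Definition is_product_measure w (mu : probability seqNat R) : Prop :=
  forall n k, mu (cylinder n k) = (\prod_(i < n) w (k i))%:E.

(* Existence: iterate on [0, 1[ with Lebesgue measure the map T that sends each
   interval [c_k, c_(k+1)[ of length w k affinely onto [0, 1[, and record the
   indices of the intervals that are visited. *)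
Section Existence.
Variable w : nat -> R.
Hypothesis w_ge0 : forall i, 0 <= w i.
Hypothesis w_sum1 : series w @ \oo --> (1 : R).

Let c : nat -> R := series w.

Let cS k : c k.+1 = c k + w k.
Proof. by rewrite /c /series /= big_nat_recr. Qed.

Let c_homo : {homo c : m n / (m <= n)%N >-> m <= n}.
Proof. by apply/nondecreasing_seqP => n; rewrite cS lerDl. Qed.

Let cell (k : nat) (x : R) := (c k <= x) && (x < c k.+1).

Let cell_uniq j k x : cell j x -> cell k x -> j = k.
Proof.
move=> /andP[j1 j2] /andP[k1 k2]; apply/eqP; rewrite eqn_leq.
apply/andP; split; rewrite leqNgt; apply/negP => /c_homo.
  by move=> h; have := lt_le_trans (le_lt_trans j1 k2) h; rewrite ltxx.
by move=> h; have := lt_le_trans (le_lt_trans k1 j2) h; rewrite ltxx.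
Qed.

Let cell_ex x : 0 <= x < 1 -> exists k, cell k x.
Proof.
move=> /andP[x0 x1].
have [n xn] : exists n, x < c n.
  have : \forall n \near \oo, x < c n by exact: (cvgr_gt 1).
  by case=> n _ /(_ n (leqnn n)) ?; exists n.
have ex : exists n, x < c n by exists n.
case: (ex_minnP ex) => -[|k] xk kmin.
  by move: xk; rewrite /c /series /= big_geq// ltNge x0.
exists k; rewrite /cell xk andbT leNgt; apply/negP => /kmin.
by rewrite ltnn.
Qed.

Let idx (x : R) : nat := xget 0%N [set k | cell k x].

Let idxE k x : cell k x -> idx x = k.
Proof.
move=> kx; rewrite /idx; case: xgetP => [j _ /= jx|/(_ k)//].
exact: cell_uniq jx kx.
Qed.

Let idx_cell x : 0 <= x < 1 -> cell (idx x) x.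
Proof. by move=> /cell_ex[k kx]; rewrite (idxE kx). Qed.

Let T (x : R) : R := (x - c (idx x)) / w (idx x).

Let itinerary (x : R) : nat -> nat := fun n => idx (iter n T x).

Let itinerary_cylinder n k : exists a, forall x,
  (0 <= x < 1 /\ cylinder n k (itinerary x)) <->
  a <= x < a + \prod_(i < n) w (k i).
Proof.
elim: n k => [|n IHn] k.
  by exists 0 => x; rewrite big_ord0 add0r; split=> [[]|?]//; split.
have [a Ha] := IHn (fun i => k i.+1).
exists (c (k 0%N) + w (k 0%N) * a) => x; rewrite big_ord_recl.
set P := \prod_(i < n) _ in Ha *.
rewrite -addrA -mulrDr.
have := w_ge0 (k 0%N); rewrite le_eqVlt => /predU1P[w0|w0].
  rewrite -w0 !mul0r addr0; split=> [[x01 cx]|/andP[h1 h2]].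
    have k0 : idx x = k 0%N := cx 0%N isT.
    have := idx_cell x01; rewrite k0 /cell cS -w0 addr0 => /andP[h1 h2].
    by have := le_lt_trans h1 h2; rewrite ltxx.
  by have := le_lt_trans h1 h2; rewrite ltxx.
split=> [[x01 cx]|].
  have kx := idx_cell x01; have k0 : idx x = k 0%N := cx 0%N isT.
  rewrite k0 in kx; move: kx; rewrite /cell cS => /andP[h1 h2].
  have TE : T x = (x - c (k 0%N)) / w (k 0%N) by rewrite /T k0.
  have /Ha : 0 <= T x < 1 /\ cylinder n (fun i => k i.+1) (itinerary (T x)).
    split; last by move=> i ni; rewrite /itinerary -iterSr; exact: cx.
    rewrite TE ler_pdivlMr// mul0r subr_ge0 h1 ltr_pdivrMr// mul1r.
    by rewrite ltrBlDl.
  rewrite TE ler_pdivlMr// ltr_pdivrMr// lerBrDl ltrBlDl.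
  by rewrite [a * _]mulrC [(a + P) * _]mulrC.
move=> hx.
have /Ha[y01 cy] : a <= (x - c (k 0%N)) / w (k 0%N) < a + P.
  rewrite ler_pdivlMr// ltr_pdivrMr// lerBrDl ltrBlDl.
  by rewrite [a * _]mulrC [(a + P) * _]mulrC.
have kx : cell (k 0%N) x.
  move: y01; rewrite ler_pdivlMr// mul0r ltr_pdivrMr// mul1r subr_ge0.
  by rewrite ltrBlDl /cell cS.
split.
  case/andP: kx => h1 h2; apply/andP; split.
    by apply: le_trans h1; rewrite -[leLHS](_ : c 0%N = 0);
      [exact: c_homo|rewrite /c /series /= big_geq].
  apply: (lt_le_trans h2); rewrite -(cvg_lim _ w_sum1)//.
  by apply: nondecreasing_cvgn_le; [exact: c_homo|exact: cvgP w_sum1].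
move=> [|i] ni; first by rewrite /itinerary /= (idxE kx).
by rewrite /itinerary iterSr /T (idxE kx); exact: cy.
Qed.

Let mcell k : measurable [set x : measurableTypeR R | cell k x].
Proof.
by rewrite [X in measurable X](_ : _ = [set` `[c k, c k.+1[]).
Qed.

Let measurable_idx i : measurable [set x : measurableTypeR R | idx x = i].
Proof.
have mS j : measurable [set x : measurableTypeR R | idx x = j.+1].
  rewrite [X in measurable X](_ : _ = [set x | cell j.+1 x]).
    exact: mcell.
  apply/seteqP; split=> x /=; last exact: idxE.
  by rewrite /idx; case: xgetP => [k _ /= kx <-|_].
case: i => //.
rewrite [X in measurable X](_ : _ =
  ~` (\bigcup_j [set x : measurableTypeR R | idx x = j.+1])).
  by apply: measurableC; exact: bigcup_measurable.
apply/seteqP; split=> x /=; first by move=> i0 [j _] /=; rewrite i0.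
by move=> h; case E : (idx x) => [//|j]; exfalso; apply: h; exists j.
Qed.

Let measurable_T : measurable_fun setT (T : measurableTypeR R -> measurableTypeR R).
Proof.
move=> _ B mB; rewrite setTI.
rewrite [X in measurable X](_ : _ = \bigcup_k
  ([set x : measurableTypeR R | idx x = k] `&`
   (fun x => (x - c k) / w k) @^-1` B)); last first.
  apply/seteqP; split=> x /=.
    by rewrite /T => Bx; exists (idx x).
  by move=> [k _ /= [kx]]; rewrite /T kx.
apply: bigcup_measurable => k _; apply: measurableI; first exact: measurable_idx.
rewrite -[X in measurable X]setTI.
have mf : measurable_fun setT
    ((fun x => (x - c k) / w k) : measurableTypeR R -> measurableTypeR R).
  by apply: measurable_funM => //; exact: measurable_funB.
exact: mf.
Qed.

Let measurable_itinerary :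
  measurable_fun setT (itinerary : measurableTypeR R -> seqNat).
Proof.
apply: (@measurability _ _ (measurableTypeR R) seqNat setT itinerary
  coordinate_sets erefl) => _ [_ [n [B ->]] <-].
rewrite setTI.
rewrite [X in measurable X](_ : _ = iter n T @^-1`
    (\bigcup_(i in B) [set x : measurableTypeR R | idx x = i])); last first.
  apply/seteqP; split=> x /=; first by move=> Bx; exists (itinerary x n).
  by move=> [i Bi /= xi]; rewrite /itinerary xi.
have mT : measurable_fun setT (iter n T : measurableTypeR R -> measurableTypeR R).
  elim: n => [|n IHn] /=; first exact: measurable_id.
  exact: measurableT_comp.
rewrite -[X in measurable X]setTI; apply: mT => //.
by apply: bigcup_measurable => i _; exact: measurable_idx.
Qed.

Lemma product_measure_exists :
  {mu : probability seqNat R | is_product_measure w mu}.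
Proof.
have mI : measurable ([set` `[0, 1[] : set (measurableTypeR R)).
  exact: measurable_itv.
pose leb := mrestr (@lebesgue_measure R) mI.
have leb1 : leb setT = 1%E.
  by rewrite /leb /mrestr setTI lebesgue_measure_itv /= lte_fin ltr01 oppr0 adde0.
pose P : probability (measurableTypeR R) R :=
  HB.pack leb (Measure_isProbability.Build _ _ _ leb leb1).
pose X : {mfun measurableTypeR R >-> seqNat} :=
  HB.pack (itinerary : measurableTypeR R -> seqNat)
    (isMeasurableFun.Build _ _ (measurableTypeR R) seqNat itinerary
       measurable_itinerary).
exists (distribution P X) => n k.
have [a Ha] := itinerary_cylinder n k.
set p := \prod_(i < n) _ in Ha *.
have p_ge0 : 0 <= p by exact: prodr_ge0.
rewrite /distribution /pushforward /= /leb /mrestr.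
rewrite [X in lebesgue_measure X](_ : _ = [set` `[a, a + p[]).
  rewrite lebesgue_measure_itv /= lte_fin ltrDl.
  by case: ltrP => [_|p0]; [rewrite -EFinB addrAC subrr add0r|
    congr EFin; apply/eqP; rewrite eq_le p_ge0].
apply/seteqP; split=> x; rewrite /= !in_itv /=; last by move=> /Ha[].
by move=> [cx x01]; apply/Ha.
Qed.

End Existence.

End ProductMeasure.

Section Alpha.
Variable R : realType.

(* A sequence (alpha_1, alpha_2, ...) is given by a : nat -> R, with
   alpha_(i+1) = a i. *)
Definition D01 : set (nat -> R) :=
  [set a | (forall i, 0 <= a i <= 1) /\ (forall i, a i.+1 <= a i)].

Definition sum_le1 (a : nat -> R) : Prop :=
  (\sum_(0 <= i <oo) (a i)%:E <= 1)%E.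

(* [weight a i] is alpha_i for all i >= 0. *)
Definition weight (a : nat -> R) (i : nat) : R :=
  if i is j.+1 then a j else 1 - fine (\sum_(0 <= j <oo) (a j)%:E)%E.

Definition pos_index (a : nat -> R) : set nat :=
  [set i | (0 < i)%N /\ 0 < weight a i].

Definition generic (a : nat -> R) (xi : nat -> nat) : Prop := forall i,
  [<-> 0 < weight a i;
       block xi i !=set0;
       infinite_set (block xi i);
       (#|[pred j : 'I_n | xi j == i]|%:R / n%:R : R) @[n --> \oo] --> weight a i
         /\ 0 < weight a i].

Section Sequence.
Variable a : nat -> R.
Hypotheses (aD : D01 a) (a1 : sum_le1 a).

Lemma alpha_sum_fin_num : (\sum_(0 <= i <oo) (a i)%:E)%E \is a fin_num.
Proof.
rewrite ge0_fin_numE; first exact: le_lt_trans a1 (ltry _).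
by apply: nneseries_ge0 => i _ _; rewrite lee_fin; case/andP: (aD.1 i).
Qed.

Lemma alpha_series_cvg : series a @ \oo --> 1 - weight a 0%N.
Proof.
have cv : (fun n => \sum_(0 <= i < n) (a i)%:E)%E @ \oo -->
    (\sum_(0 <= i <oo) (a i)%:E)%E.
  apply: is_cvg_nneseries => i _ _.
  by rewrite lee_fin; case/andP: (aD.1 i).
rewrite /= opprB addrC subrK.
rewrite (_ : series a = fine \o (fun n => \sum_(0 <= i < n) (a i)%:E)%E).
  by apply: fine_cvg; rewrite fineK ?alpha_sum_fin_num.
by apply/funext => n; rewrite /= sumEFin.
Qed.

Lemma weight_ge0 i : 0 <= weight a i.
Proof.
case: i => [|j] /=; last by case/andP: (aD.1 j).
by rewrite subr_ge0 -lee_fin; apply: le_trans a1; rewrite fineK ?alpha_sum_fin_num.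
Qed.

Lemma weight_sum1 : series (weight a) @ \oo --> (1 : R).
Proof.
rewrite -(cvg_shiftS (series (weight a))).
rewrite (_ : (fun n => _) = fun n => weight a 0%N + series a n).
  rewrite (_ : 1 = weight a 0%N + (1 - weight a 0%N)); last by rewrite addrC subrK.
  by apply: cvgD; [exact: cvg_cst|exact: alpha_series_cvg].
by apply/funext => n; rewrite /series /= big_nat_recl.
Qed.

Definition mu_alpha : probability seqNat R :=
  sval (product_measure_exists weight_ge0 weight_sum1).

Lemma mu_alphaP : is_product_measure (weight a) mu_alpha.
Proof. exact: svalP. Qed.

Definition f_alpha (A : sign_subgroup (pos_index a)) (xi : seqNat) :
    BorelSub FinN :=
  if `[< generic a xi >] then mkSub (sign_preimage_group A xi)
  else trivial_subgroup FinN.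

(* [f_alpha A] depends on finitely many values of xi for each membership
   question, besides the Borel condition of genericity, so it is measurable and
   the second branch is the law of the random subgroup H_xi. *)
Definition nu_alpha (A : sign_subgroup (pos_index a)) :
    set (BorelSub FinN) -> \bar R :=
  if weight a 0%N == 1 then dirac (trivial_subgroup FinN : BorelSub FinN)
  else pushforward mu_alpha (f_alpha A).

End Sequence.
End Alpha.

(* Main.v *)
From HB Require Import structures.
Require Import Defs.
From mathcomp Require Import all_boot all_order all_algebra all_fingroup.
From mathcomp Require Import all_classical all_reals all_analysis.
From mathcomp Require Import measurable_realfun.
From mathcomp Require Import zify lra.

(** Let H be the ergodic random subgroup, and call the orbits of H blocks.

   Almost surely every block is either a fixed point or a set of positive
   asymptotic frequency. Indeed, conjugation invariance makes the events that x
   and j are in the same block, for j different from x, exchangeable, so a law of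
   large numbers gives each block a frequency ([exchangeable_freq_cvg]);
   and if the block of x has frequency zero, then the equally likely events that
   it contains j have vanishing frequency, hence are null ([ae_dust_fixed]).
   The same recurrence principle shows that if g is in H and moves b to x, then
   infinitely many conjugates of g by transpositions (x y) are in H
   ([ae_recurrent]). The quotient of such a conjugate by g is a 3-cycle on
   x, b, y, and commutators of these 3-cycles give all 3-cycles within a block.
   Thus H contains the alternating group of each of its blocks, so it is
   determined by the blocks and by the group A of the sign vectors of its
   elements ([sign_preimage_of_cycles]). If xi labels the blocks by 1, 2, ... in
   decreasing order of frequency alpha_1, alpha_2, ... and the fixed points by 0,
   then H is the subgroup attached to xi and A, and no mass is lost: the fixed
   points have frequency alpha_0 ([typical_structure]).

   It remains to compare the law nu of H with the law nu_alpha^A obtained from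
   one fixed typical H. A probability measure on the space of subgroups is
   determined by the probabilities that H contains F, for finite sets F of
   permutations ([BorelSub_generated], [contains_setI]). Let F be supported
   below m, and consider the proportion of the maps t from m to n which are
   injective and carry F into H. Whether they do depends only on the labels
   xi (t i), i < m, whose joint law when t is random is a power of the empirical
   law of xi below n; so as n grows the proportion tends to the probability that
   the subgroup attached to an alpha-distributed sequence of labels contains F
   ([cvg_sample], [cvg_copies]). On the other hand the mean of the proportion over
   nu is essentially nu(F contained in H), and its limit is invariant under
   conjugation, hence almost surely constant by ergodicity
   ([ae_limsup_copies]). So the two probabilities agree for almost every H. As
   the countably many F are treated simultaneously and a single H is chosen, ties
   between the frequencies and the choice of A require no further argument. *)

Set Implicit Arguments.
Unset Strict Implicit.
Unset Printing Implicit Defensive.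

Import Order.TTheory GRing.Theory Num.Theory.
Import numFieldNormedType.Exports.

Local Open Scope classical_set_scope.
Local Open Scope ring_scope.

(** * Transpositions and 3-cycles in Fin(N) *)

Definition swap_fun (x y n : nat) : nat :=
  if n == x then y else if n == y then x else n.

Lemma swap_funK x y : involutive (swap_fun x y).
Proof.
move=> n; rewrite /swap_fun; have [->|nx] := eqVneq n x.
  by rewrite eqxx; case: eqVneq.
by have [->|ny] := eqVneq n y; rewrite ?eqxx// (negbTE nx) (negbTE ny).
Qed.

Definition swap (x y : nat) : FinN.
Proof.
exists (swap_fun x y); first exact/inv_bij/swap_funK.
apply: (@sub_finite_set _ _ [set x; y]); last exact: finite_set2.
move=> n /=; rewrite /swap_fun; case: eqVneq => [->|_]; first by left.
by case: eqVneq => [->|//]; right.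
Defined.

Lemma swapL x y : swap x y x = y.
Proof. by rewrite /= /swap_fun eqxx. Qed.

Lemma swapR x y : swap x y y = x.
Proof. by rewrite /= /swap_fun eqxx; case: eqVneq. Qed.

Lemma swapD x y n : n <> x -> n <> y -> swap x y n = n.
Proof. by rewrite /= /swap_fun => /eqP/negbTE-> /eqP/negbTE->. Qed.

Lemma swapV x y : (swap x y)^-1%g = swap x y.
Proof.
apply: FinN_ext => n; apply: (@FinN_inj (swap x y)).
by rewrite FinN_mulgV /= swap_funK.
Qed.

Lemma FinN_mulVg (g : FinN) n : g^-1%g (g n) = n.
Proof. by rewrite -FinN_mulE mulVg. Qed.

Lemma FinN_invE (g : FinN) x y : g x = y -> g^-1%g y = x.
Proof. by move=> <-; rewrite FinN_mulVg. Qed.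

Lemma swap_sgn x y : x <> y -> FinN_sgn (swap x y) = -1.
Proof.
move=> xy; set N := (maxn x y).+1.
have gN : fixes_above (swap x y) N.
  by move=> n Nn; apply: swapD => ?; subst n; move: Nn; rewrite /N; lia.
have xN : (x < N)%N by rewrite /N; lia.
have yN : (y < N)%N by rewrite /N; lia.
rewrite (FinN_sgnE gN).
suff -> : Defs.restr_perm gN = tperm (Ordinal xN) (Ordinal yN).
  by rewrite odd_tperm -(inj_eq val_inj)/=; move/eqP: xy => ->.
apply/permP => i; apply: val_inj; rewrite [in LHS]permE [LHS]ord_restrE//.
case: tpermP => [->|->|/eqP ix /eqP iy] /=.
- by rewrite /swap_fun eqxx.
- by rewrite /swap_fun eqxx; case: eqVneq.
- by move: ix iy; rewrite -!(inj_eq val_inj)/= /swap_fun => /negbTE-> /negbTE->.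
Qed.

Definition cyc (x y z : nat) : FinN := (swap x y * swap y z)%g.

Section Cyc.
Variables x y z : nat.
Hypotheses (xy : x <> y) (yz : y <> z) (xz : x <> z).

Lemma cyc1 : cyc x y z x = y.
Proof. by rewrite FinN_mulE (swapD xy)// swapL. Qed.
Lemma cyc2 : cyc x y z y = z.
Proof. by rewrite FinN_mulE swapL swapD//; exact/nesym. Qed.
Lemma cyc3 : cyc x y z z = x.
Proof. by rewrite FinN_mulE swapR swapR. Qed.
Lemma cycD n : n <> x -> n <> y -> n <> z -> cyc x y z n = n.
Proof. by move=> nx ny nz; rewrite FinN_mulE !swapD. Qed.

Lemma cyc_unique (g : FinN) : g x = y -> g y = z -> g z = x ->
  (forall n, n <> x -> n <> y -> n <> z -> g n = n) -> g = cyc x y z.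
Proof.
move=> g1 g2 g3 gD; apply: FinN_ext => n.
have [->|/eqP nx] := eqVneq n x; first by rewrite cyc1.
have [->|/eqP ny] := eqVneq n y; first by rewrite cyc2.
have [->|/eqP nz] := eqVneq n z; first by rewrite cyc3.
by rewrite gD// cycD.
Qed.

Lemma cyc_sgn : FinN_sgn (cyc x y z) = 1.
Proof. by rewrite FinN_sgnM !swap_sgn. Qed.

End Cyc.

Lemma cycV x y z : x <> y -> y <> z -> x <> z ->
  (cyc x y z)^-1%g = cyc z y x.
Proof.
move=> xy yz xz.
apply: cyc_unique; try exact/nesym.
- by apply: FinN_invE; rewrite cyc2.
- by apply: FinN_invE; rewrite cyc1.
- by apply: FinN_invE; rewrite cyc3.
- by move=> n nz ny nx; apply: FinN_invE; rewrite cycD.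
Qed.

Lemma cyc_conj (g : FinN) x y z : x <> y -> y <> z -> x <> z ->
  (g * cyc x y z * g^-1)%g = cyc (g x) (g y) (g z).
Proof.
move=> xy yz xz.
have gi u v : u <> v -> g u <> g v by move=> uv /FinN_inj.
have gxy := gi _ _ xy; have gyz := gi _ _ yz; have gxz := gi _ _ xz.
apply: cyc_unique => //.
- by rewrite 2!FinN_mulE FinN_mulVg cyc1.
- by rewrite 2!FinN_mulE FinN_mulVg cyc2.
- by rewrite 2!FinN_mulE FinN_mulVg cyc3.

- move=> n nx ny nz; rewrite 2!FinN_mulE cycD ?FinN_mulgV//.
  + by move=> gn; apply: nx; rewrite -gn FinN_mulgV.
  + by move=> gn; apply: ny; rewrite -gn FinN_mulgV.
  + by move=> gn; apply: nz; rewrite -gn FinN_mulgV.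
Qed.

(** If g sends b to x and fixes y, then g and its conjugate by the
   transposition (x y) agree except near x and y, and their quotient is a
   3-cycle. *)
Lemma cyc_of_conj (g : FinN) x b y : g b = x -> b <> x -> g y = y -> y <> b ->
  (g^-1 * (g ^ swap x y))%g = cyc x b y.
Proof.
move=> gb bx gy yb.
have xNy : x <> y by move=> xy; apply: yb; apply: (@FinN_inj g); rewrite gb gy.
rewrite conjgE swapV.
have gx : g x <> x by rewrite -{2}gb => /FinN_inj xb; apply: bx.
have gxy : g x <> y by rewrite -gy => /FinN_inj.
have gV : g^-1%g x = b by exact: FinN_invE.
apply: cyc_unique => //; rewrite ?FinN_mulE.
- exact/nesym.
- by move=> ?; apply: yb.
- by rewrite swapL gy swapR.
- by rewrite (@swapD _ _ b)// ?gb ?swapL; [exact: FinN_invE|exact/nesym].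
- by rewrite swapR swapD// FinN_mulVg.
- move=> n nx nb ny; rewrite !FinN_mulE (swapD nx ny) swapD ?FinN_mulVg//.
  + by rewrite -gb => /FinN_inj.
  + by rewrite -gy => /FinN_inj.
Qed.

(** Two 3-cycles whose supports meet in a single point have a 3-cycle as
   commutator; hence a 3-cycle through x and y and another one through y and z
   yield a 3-cycle on x, y and z. *)
Lemma cyc_commutator x y z u v : uniq [:: x; y; z; u; v] ->
  ((cyc x y u)^-1 * cyc y z v * cyc x y u * (cyc y z v)^-1)%g = cyc y x z.
Proof.
rewrite /= !inE !negb_or => /and5P[/and4P[/eqP xy /eqP xz /eqP xu /eqP xv]].
move=> /and3P[/eqP yz /eqP yu /eqP yv] /andP[/eqP zu /eqP zv].
move=> /eqP uv _.
set p := cyc x y u; set q := cyc y z v.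
have -> : (p^-1 * q * p)%g = cyc x z v.
  rewrite -{2}[p]invgK /q cyc_conj//.
  by congr cyc; apply: FinN_invE; rewrite ?cyc1//; apply: cycD => //; exact/nesym.
have yx := nesym xy; have zx := nesym xz; have zy := nesym yz.
have ux := nesym xu; have uy := nesym yu; have uz := nesym zu.
have vx := nesym xv; have vy := nesym yv; have vz := nesym zv.
rewrite cycV//; apply: cyc_unique => //.
- by rewrite FinN_mulE cyc3// cyc3.
- by rewrite FinN_mulE (@cycD v)// cyc1.
- by rewrite FinN_mulE (@cyc2 v)// cycD.
- move=> n ny nx nz; rewrite FinN_mulE.
  have [->|/eqP nv] := eqVneq n v; first by rewrite (@cyc1 v)// cyc2.
  by rewrite (@cycD v)// cycD.
Qed.

(** * Subgroups containing the alternating groups of their orbits *)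

Section SubTheory.
Variables (G : groupType) (H : Defs.Sub G).

Lemma Sub_closed : group_closed (val H : {pred G}).
Proof. by case: H => K /= /set_mem. Qed.

Lemma Sub1 : val H 1%g.
Proof. by case: Sub_closed. Qed.

Lemma SubV g : val H g -> val H g^-1%g.
Proof. by move=> Hg; have := (Sub_closed.2 1%g g Sub1 Hg); rewrite mul1g. Qed.

Lemma SubM g h : val H g -> val H h -> val H (g * h)%g.
Proof.
by move=> Hg Hh; have := (Sub_closed.2 g h^-1%g Hg (SubV Hh)); rewrite invgK.
Qed.

End SubTheory.

Lemma Sub_eq (G : groupType) (H K : Defs.Sub G) : val H =1 val K -> H = K.
Proof. by move=> /funext /val_inj. Qed.

Lemma sgn_conj (g h : FinN) : FinN_sgn (g ^ h)%g = FinN_sgn g.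
Proof.
rewrite conjgE !FinN_sgnM FinN_sgnV mulrC -mulrA.
by case: (FinN_sgn_pm1 g) => ->; case: (FinN_sgn_pm1 h) => ->.
Qed.

Section SignPreimage.
Variables (I : set nat) (A : sign_subgroup I).

Let sign_preimage_local_imp xi xi' m f : (forall n, (n < m)%N -> xi n = xi' n) ->
  fixes_above f m -> sign_preimage A xi f -> sign_preimage A xi' f.
Proof.
move=> xiE fm /asboolP[tau [[tB t1 tf] Atau ftau]]; apply/asboolP.
have tm i n : (m <= n)%N -> tau i n = n.
  move=> mn; have [Ii|/t1 ->//] := pselect (I i).
  have [<-|xin] := pselect (xi n = i); last exact: tB.
  by rewrite -ftau fm.
exists tau; split=> //; first split=> // i n Ii Bn.
  have [/tm//|nm] := leqP m n; apply: tB => //.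
  by rewrite /block /= xiE.
move=> n; have [mn|nm] := leqP m n; first by rewrite fm// tm.
by rewrite ftau xiE.
Qed.

(** The sampling argument rests on this: finitely many labels decide whether f
   belongs to the subgroup attached to xi. *)
Lemma sign_preimage_local xi xi' m f : (forall n, (n < m)%N -> xi n = xi' n) ->
  fixes_above f m -> sign_preimage A xi f = sign_preimage A xi' f.
Proof.
move=> xiE fm; apply/idP/idP; apply: sign_preimage_local_imp fm => // n nm.
by rewrite xiE.
Qed.

Let sign_preimage_conj_imp xi f (r : FinN) :
  sign_preimage A xi (f ^ r^-1)%g -> sign_preimage A (xi \o r) f.
Proof.
move=> /asboolP[tau [[tB t1 tf] Atau ftau]]; apply/asboolP.
exists (fun i => tau i ^ r)%g; split.
- split.
  + move=> i n Ii Bn; rewrite conjgE !FinN_mulE tB ?FinN_mulVg//.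
  + by move=> i /t1->; rewrite conj1g.
  + apply: sub_finite_set tf => i /= ti t1i; apply: ti.
    by rewrite t1i conj1g.
- by rewrite (_ : sign_map _ = sign_map tau)//; apply/funext => i; exact: sgn_conj.
- move=> n; rewrite conjgE 2!FinN_mulE -(ftau (r n)) conjgE invgK 2!FinN_mulE.
  by rewrite !FinN_mulVg.
Qed.

Lemma sign_preimage_conj xi f (r : FinN) :
  sign_preimage A xi (f ^ r^-1)%g = sign_preimage A (xi \o r) f.
Proof.
apply/idP/idP; first exact: sign_preimage_conj_imp.
have := @sign_preimage_conj_imp (xi \o r) (f ^ r^-1)%g r^-1%g.
rewrite invgK conjgKV; move=> + fS => /(_ fS).
by rewrite (_ : _ \o _ = xi)//; apply/funext => n /=; rewrite FinN_mulgV.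
Qed.

End SignPreimage.

Section Structure.
Variables (I : set nat) (H : Defs.Sub FinN) (xi : nat -> nat).
Hypothesis Hxi : forall g n, val H g -> xi (g n) = xi n.
Hypothesis Hfix : forall g n, val H g -> ~ I (xi n) -> g n = n.
Hypothesis Hcyc : forall x y z, x <> y -> y <> z -> x <> z ->
  xi y = xi x -> xi z = xi x -> I (xi x) -> val H (cyc x y z).

(** Induction on the size of the support: if g moves x to y, then some third
   point z of the same block is moved, since the restriction of g to the block
   is even, and composing with the 3-cycle on y, x, z makes x a fixed point. *)
Let even_in_subgroup tau g : block_sum I xi tau -> glues xi tau g ->
  (forall i, FinN_sgn (tau i) = 1) -> val H g.
Proof.
have [N gN] := FinN_bound g.
have [k] := ubnP (\sum_(n < N) (g n != n)).
elim: k => // k IHk in tau g gN *; rewrite ltnS => gk tS gt tau1.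
have [tB t1 tf] := tS.
have [g1|] := pselect (g =1 id); first by rewrite (_ : g = 1%g) ?Sub1//; exact: FinN_ext.
move=> /existsNP[x gx]; set y := g x in gx.
set i := xi x.
have Ii : I i.
  by apply: contrapT => /t1 ti; apply: gx; rewrite /y gt -/i ti.
have yE : y = tau i x by rewrite /y gt.
have xiy : xi y = i by rewrite yE; exact: (block_sum_stable tS).
have [z [zx zy tz]] : exists z, [/\ z <> x, z <> y & tau i z <> z].
  apply: contrapT => noz; have : tau i = swap x y.
    have tD n : n <> x -> n <> y -> tau i n = n.
      by move=> nx ny; apply: contrapT => tn; apply: noz; exists n.
    apply: FinN_ext => n; have [->|/eqP nx] := eqVneq n x; first by rewrite swapL.
    have [->|/eqP ny] := eqVneq n y; last by rewrite swapD// tD.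
    rewrite swapR; have [//|/eqP ty] := eqVneq (tau i y) x.
    have tyy : tau i y <> y by rewrite {2}yE => /FinN_inj.
    by have := tD _ ty tyy => /FinN_inj.
  move=> tE; have := tau1 i; rewrite tE swap_sgn//; exact/nesym.
have xiz : xi z = i by apply: contrapT => /(tB i z Ii).
have gz : g z <> z by rewrite gt xiz.
have gy : g y <> y by rewrite {2}/y => /FinN_inj.
pose c := cyc y x z.
have cH : val H c by apply: Hcyc; rewrite ?xiz ?xiy//; exact/nesym.
pose tau' j := if j == i then (c * tau i)%g else tau j.
have cB n : xi n <> i -> c n = n.
  by move=> ni; apply: cycD; try (by move=> nE; apply: ni; rewrite nE);
   try exact/nesym.
have cxi n : xi (c n) = xi n by rewrite Hxi.
have tS' : block_sum I xi tau'.
  split.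
  - move=> j n Ij Bn; rewrite /tau'; case: eqVneq => [ji|_]; last exact: tB.
    by rewrite FinN_mulE tB ?cB// -ji.
  - by move=> j Ij; rewrite /tau'; case: eqVneq => [ji|_]; [case: Ij; rewrite ji|exact: t1].
  - apply: (@sub_finite_set _ _ ([set j | tau j <> 1%g] `|` [set i])).
      by move=> j; rewrite /tau' /=; case: eqVneq => [ji|_]; [right|left].
    by rewrite finite_setU.
have gt' : glues xi tau' (c * g)%g.
  move=> n; rewrite FinN_mulE /tau' gt; case: eqVneq => [->//|ni].
  by rewrite cB// (block_sum_stable tS)//; exact/eqP.
have gc n : g n = n -> (c * g)%g n = n.
  by move=> gn; rewrite FinN_mulE gn; apply: cycD;
    try (by move=> nE; rewrite nE in gn); exact/nesym.
suff : val H (c * g)%g by move=> /(SubM (SubV cH)); rewrite mulKg.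
apply: (IHk tau') => //.
- by move=> n Nn; rewrite gc// gN.
- have xN : (x < N)%N by rewrite ltnNge; apply/negP => /gN.
  have cgx : (c * g)%g x = x.
    by rewrite FinN_mulE -/y cyc1//; exact/nesym.
  apply: leq_trans gk.
  rewrite (bigD1 (Ordinal xN))// [leqRHS](bigD1 (Ordinal xN))//.
  have -> : ((c * g)%g (Ordinal xN) != Ordinal xN :> nat) = false.
    by apply/negbTE; rewrite negbK; exact/eqP.
  have -> : (g (Ordinal xN) != Ordinal xN :> nat) by exact/eqP.
  rewrite /= add0n add1n ltnS; apply: leq_sum => n _.
  have [gn|_] := eqVneq (g n) n; last exact: leq_b1.
  by have := gc _ gn; rewrite /= => ->; rewrite eqxx.
- move=> j; rewrite /tau'; case: eqVneq => _; last exact: tau1.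
  by rewrite FinN_sgnM tau1 mulr1 cyc_sgn//; exact/nesym.
Qed.

Let signs_of_H : set (nat -> int) :=
  [set e | exists tau g, [/\ block_sum I xi tau, glues xi tau g, val H g & e = sign_map tau]].

Let block_sumM tau rho : block_sum I xi tau -> block_sum I xi rho ->
  block_sum I xi (fun i => tau i * rho i)%g.
Proof.
move=> [tB t1 tf] [rB r1 rf]; split.
- by move=> i n Ii Bn; rewrite FinN_mulE rB// tB.
- by move=> i Ii; rewrite t1// r1// mulg1.
- apply: (@sub_finite_set _ _ ([set i | tau i <> 1%g] `|` [set i | rho i <> 1%g])).
    move=> i /= pr; have [p1i|] := pselect (tau i = 1%g); last by left.
    by right=> ri; apply: pr; rewrite p1i ri mulg1.
  by rewrite finite_setU.
Qed.

Let block_sumV tau : block_sum I xi tau -> block_sum I xi (fun i => (tau i)^-1)%g.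
Proof.
move=> [tB t1 tf]; split.
- by move=> i n Ii Bn; apply: FinN_invE; rewrite tB.
- by move=> i Ii; rewrite t1// invg1.
- by apply: sub_finite_set tf => i /= ti t1i; apply: ti; rewrite t1i invg1.
Qed.

Let gluesM tau rho g h : block_sum I xi rho -> glues xi tau g -> glues xi rho h ->
  glues xi (fun i => tau i * rho i)%g (g * h)%g.
Proof.
by move=> rS gt hr n; rewrite !FinN_mulE gt hr (block_sum_stable rS).
Qed.

Let gluesV tau g : block_sum I xi tau -> glues xi tau g ->
  glues xi (fun i => (tau i)^-1)%g (g^-1)%g.
Proof.
move=> tS gt n; apply: FinN_invE; rewrite gt.
by rewrite (block_sum_stable (block_sumV tS)) // FinN_mulgV.
Qed.

Let signs_of_H_subgroup : sign_subgroup I.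
Proof.
apply: (@SignSubgroup I signs_of_H).
- move=> _ [tau [g [[tB t1 tf] gt Hg ->]]]; split.
  + by move=> i; exact: FinN_sgn_pm1.
  + by move=> i /t1 ti; rewrite /sign_map ti FinN_sgn1.
  + by apply: sub_finite_set tf => i /= s1 ti; apply: s1; rewrite /sign_map ti FinN_sgn1.
- exists (fun=> 1%g), 1%g; split=> //; [split=> //|exact: Sub1|].
  + by rewrite [X in finite_set X](_ : _ = set0)// -subset0 => i /=.
  + by apply/funext => i; rewrite /sign_map FinN_sgn1.
- move=> _ _ [tau [g [tS gt Hg ->]]] [rho [h [rS hr Hh ->]]].
  exists (fun i => tau i * rho i)%g, (g * h)%g; split.
  + exact: block_sumM.
  + exact: gluesM.
  + exact: SubM.
  + by apply/funext => i; rewrite /sign_map FinN_sgnM.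
- move=> _ [tau [g [tS gt Hg ->]]]; by exists tau, g.
Defined.

Let glue_parts g : val H g -> exists2 tau, block_sum I xi tau & glues xi tau g.
Proof.
move=> Hg; pose part i n := if xi n == i then g n else n.
have partK (h k : FinN) i : val H h -> (forall n, k (h n) = n) ->
    cancel (fun n => if xi n == i then h n else n) (fun n => if xi n == i then k n else n).
  move=> Hh kh n; have [xn|xn] := eqVneq (xi n) i; last by rewrite (negbTE xn).
  by rewrite Hxi// xn eqxx kh.
have partB i : bijective (part i).
  exists (fun n => if xi n == i then g^-1%g n else n).
    by apply: partK => // n; rewrite FinN_mulVg.
  by apply: partK => [|n]; [exact: SubV|rewrite FinN_mulgV].
have partF i : finite_set [set n | part i n <> n].
  by apply: sub_finite_set (FinN_supp g) => n /=; rewrite /part; case: eqP.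
exists (fun i => mkFinN (partB i) (partF i)); last by move=> n; rewrite /= /part eqxx.
split.
- by move=> i n Ii Bn /=; rewrite /part; case: eqP.
- move=> i Ii; apply: FinN_ext => n /=; rewrite /part; case: eqP => // xn.
  by apply: Hfix => //; rewrite xn.
- have [N gN] := FinN_bound g.
  apply: (@sub_finite_set _ _ [set xi n | n in [set n | (n < N)%N]]); last first.
    by apply: finite_image; exact: finite_II.
  move=> i /= pi1; apply: contrapT => nN; apply: pi1; apply: FinN_ext => n /=.
  rewrite /part; case: eqP => // xn; apply: gN; rewrite leqNgt; apply/negP => nltN.
  by apply: nN; exists n.
Qed.

(** Two elements of the subgroup attached to xi with the same sign vector
   differ by an element that is even on every block. *)
Lemma sign_preimage_of_cycles :
  exists A : sign_subgroup I, val H =1 sign_preimage A xi.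
Proof.
exists signs_of_H_subgroup => g; apply/idP/asboolP.
  move=> Hg; have [tau tS gt] := glue_parts Hg.
  by exists tau; split=> //; exists tau, g.
move=> [tau [tS [rho [h [rS hr Hh tr]]] gt]].
suff : val H (g * h^-1)%g by move=> /SubM/(_ Hh); rewrite mulgKV.
apply: (even_in_subgroup (block_sumM tS (block_sumV rS))).
  by apply: gluesM => //; [exact: block_sumV|exact: gluesV].
move=> i; rewrite FinN_sgnM FinN_sgnV.
have := congr1 (@^~ i) tr; rewrite /sign_map => ->.
by case: (FinN_sgn_pm1 (rho i)) => ->.
Qed.

End Structure.

(** * Frequencies of sets of natural numbers *)

Section Frequency.
Variable R : realType.
Implicit Types U V : nat -> Prop.

Definition count_below U (n : nat) : nat := (\sum_(j < n) `[< U j >])%N.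

Definition freq U (n : nat) : R := (count_below U n)%:R / n%:R.

Lemma countS U n : count_below U n.+1 = (count_below U n + `[< U n >])%N.
Proof. by rewrite /count_below big_ord_recr. Qed.

Lemma count_le U n : (count_below U n <= n)%N.
Proof.
elim: n => [|n IHn]; first by rewrite /count_below big_ord0.
by rewrite countS; lia.
Qed.

Lemma freq_ge0 U n : 0 <= freq U n.
Proof. by rewrite /freq mulr_ge0. Qed.

Lemma freq_le1 U n : freq U n <= 1.
Proof.
case: n => [|n]; first by rewrite /freq invr0 mulr0.
by rewrite /freq ler_pdivrMr// mul1r ler_nat count_le.
Qed.

Lemma freq_eq U V n : (forall j, U j <-> V j) -> freq U n = freq V n.
Proof.
move=> UV; rewrite /freq /count_below; congr (_%:R / _); apply: eq_bigr => j _.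
by congr nat_of_bool; apply/asboolP/asboolP => /UV.
Qed.

Lemma freq_perm U (g : FinN) n : fixes_above g n ->
  freq (fun j => U (g j)) n = freq U n.
Proof.
move=> gn; rewrite /freq /count_below; congr (_%:R / _).
rewrite [RHS](reindex_inj (@perm_inj _ (Defs.restr_perm gn))).
by apply: eq_bigr => j _; rewrite permE ord_restrE.
Qed.

Lemma count_homo U m n : (m <= n)%N ->
  (count_below U m <= count_below U n <= count_below U m + (n - m))%N.
Proof.
move=> /subnKC nE; rewrite -{1 2}nE; elim: (n - m)%N => [|k IHk].
  by rewrite !addn0 leqnn.
by rewrite addnS countS; lia.
Qed.

Lemma freq_dist U m n : (0 < m <= n)%N ->
  `|freq U n - freq U m| <= (n - m)%:R / m%:R.
Proof.
move=> /andP[m0 mn]; have /andP[h1 h2] := count_homo U mn.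
have m0' : 0 < m%:R :> R by rewrite ltr0n.
have n0' : 0 < n%:R :> R by rewrite ltr0n (leq_trans m0).
have cn : (count_below U m)%:R <= m%:R :> R by rewrite ler_nat count_le.
have h1' : (count_below U m)%:R <= (count_below U n)%:R :> R by rewrite ler_nat.
have h2' : (count_below U n)%:R <= (count_below U m)%:R + (n%:R - m%:R) :> R.
  by rewrite -natrB// -natrD ler_nat.
have mn' : m%:R <= n%:R :> R by rewrite ler_nat.
have c0 : 0 <= (count_below U m)%:R :> R by [].
rewrite natrB// /freq; set a := (count_below U n)%:R in h1' h2' *.
set b := (count_below U m)%:R in h1' h2' cn c0 *.
rewrite ler_norml; apply/andP; split.
  rewrite -mulNr lerBrDr -mulrDl ler_pdivrMr// mulrAC ler_pdivlMr//.
  by nra.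
by rewrite lerBlDr -mulrDl ler_pdivrMr// mulrAC ler_pdivlMr//; nra.
Qed.

(** Between consecutive fourth powers the frequency changes by O(1/k), so this
   sparse subsequence decides the convergence. *)
Lemma freq_cvg_sub U (l : R) :
  freq U (k.+1 ^ 4)%N @[k --> \oo] --> l -> freq U n @[n --> \oo] --> l.
Proof.
move=> fl; apply/cvgrPdist_le => e e0.
have e20 : 0 < e / 2 by rewrite divr_gt0.
have : \forall k \near \oo, `|l - freq U (k.+1 ^ 4)%N| <= e / 2.
  by move/cvgrPdist_le : fl; exact.
case=> K _ HK; pose L := (maxn K (Num.truncn (15 / (e / 2))).+1).
exists (L.+1 ^ 4)%N => // n /= Ln.
(* The last fourth power not exceeding n. *)
have ex : exists k, (k ^ 4 <= n)%N by exists 0%N.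
have bd k : (k ^ 4 <= n)%N -> (k <= n)%N.
  by apply: leq_trans; case: k => // k; rewrite -{1}[k.+1]expn1 leq_pexp2l.
case: (ex_maxnP ex bd) => k kn kmax.
have := kmax _ Ln; case: k kn kmax => // k kn kmax; rewrite ltnS => Lk.
have nk : (n < k.+2 ^ 4)%N by rewrite ltnNge; apply/negP => /kmax; rewrite ltnn.
have Kk : (K <= k)%N by apply: leq_trans Lk; rewrite leq_maxl.
have := HK k Kk; have : `|freq U n - freq U (k.+1 ^ 4)%N| <= e / 2.
  apply: (le_trans (freq_dist U _)); first by rewrite expn_gt0.
  have Tk : (15 / (e / 2) : R) <= k.+1%:R.
    apply/ltW/(lt_le_trans (truncnS_gt _)); rewrite ler_nat.
    by apply: (leq_trans _ (leqW Lk)); rewrite leq_maxr.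
  have k0 : 0 < k.+1%:R :> R by [].
  rewrite ler_pdivrMr ?ltr0n ?expn_gt0//.
  rewrite ler_pdivrMr// in Tk.
  apply: (@le_trans _ _ (15 * k.+1%:R ^+ 3)).
    rewrite -natrX -natrM ler_nat; nia.
  rewrite natrX [_ ^+ 4]exprSr.
  have : 0 <= k.+1%:R ^+ 3 :> R by rewrite exprn_ge0.
  by move: (k.+1%:R ^+ 3) => c c0; nra.
rewrite -[X in _ -> _ -> X <= _]normrN opprB.
move=> h1 h2; rewrite [leRHS](splitr e).
have -> : freq U n - l = (freq U n - freq U (k.+1 ^ 4)%N) - (l - freq U (k.+1 ^ 4)%N).
  by rewrite opprB addrA subrK.
by apply: (le_trans (ler_normB _ _)); exact: lerD.
Qed.

Lemma freq_shift U s (l : R) :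
  freq (fun j => U (j + s)%N) n @[n --> \oo] --> l -> freq U n @[n --> \oo] --> l.
Proof.
elim: s U l => [|s IHs] U l.
  by rewrite (_ : (fun j => _) = U)//; apply/funext => j; rewrite addn0.
rewrite (_ : (fun j => _) = (fun j => U (j + s).+1)); last first.
  by apply/funext => j; rewrite addnS.
move=> /(IHs (fun j => U j.+1)) {IHs} cl.
rewrite -(cvg_shiftS (freq U)).
apply: (@squeeze_cvgr _ _ _ _ (fun n => freq (fun j => U j.+1) n - n.+1%:R^-1)
   (fun n => freq (fun j => U j.+1) n + n.+1%:R^-1)).
- near=> n; rewrite -ler_distl /=.
  have n0 : 0 < n%:R :> R by rewrite ltr0n; near: n; exists 1%N.
  have -> : freq U n.+1 = (`[< U 0%N >]%:R + (count_below (fun j => U j.+1) n)%:R) / n.+1%:R.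
    by rewrite /freq /count_below big_ord_recl natrD.
  have cn : (count_below (fun j => U j.+1) n)%:R <= n%:R :> R by rewrite ler_nat count_le.
  rewrite /freq; set c := (count_below _ _)%:R in cn *.
  have c0 : 0 <= c by rewrite /c.
  have n1 : 0 < n.+1%:R :> R by [].
  have -> : (`[< U 0%N >]%:R + c) / n.+1%:R - c / n%:R =
      ((`[< U 0%N >]%:R * n%:R - c) / n%:R) / n.+1%:R.
    apply: (mulIf (lt0r_neq0 n1)); rewrite mulrBl !divfK ?gt_eqF//.
    have -> : c / n%:R * n.+1%:R = c + c / n%:R.
      by rewrite -natr1 mulrDr mulr1 divfK ?gt_eqF.
    by rewrite mulrBl mulfK ?gt_eqF// opprD addrA addrK.
  rewrite normrM [X in _ * X]ger0_norm ?invr_ge0//.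
  rewrite ler_piMl ?invr_ge0// ler_norml ler_pdivlMr// ler_pdivrMr//.
  by case: `[< _ >]; rewrite /=; nra.
- rewrite -[X in _ --> X]subr0; apply: cvgB => //; exact: cvg_harmonic.
- rewrite -[X in _ --> X]addr0; apply: cvgD => //; exact: cvg_harmonic.
Unshelve. all: by end_near. Qed.

End Frequency.

(** * Measurability *)

Section MeasurablePredicates.
Context d (T : measurableType d).
Implicit Types P Q : T -> Prop.

Lemma measurable_exists (P : nat -> T -> Prop) :
  (forall n, measurable [set x | P n x]) -> measurable [set x | exists n, P n x].
Proof.
move=> mP; rewrite [X in measurable X](_ : _ = \bigcup_n [set x | P n x]).
  exact: bigcupT_measurable.
by apply/seteqP; split=> x /= [n]; [exists n|move=> _; exists n].
Qed.

Lemma measurable_forall (P : nat -> T -> Prop) :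
  (forall n, measurable [set x | P n x]) -> measurable [set x | forall n, P n x].
Proof.
move=> mP; rewrite [X in measurable X](_ : _ = \bigcap_n [set x | P n x]).
  exact: bigcapT_measurable.
by apply/seteqP; split=> x /= Px n; [move=> _; exact: Px|exact: Px].
Qed.

Lemma measurable_not P : measurable [set x | P x] -> measurable [set x | ~ P x].
Proof. exact: measurableC. Qed.

Lemma measurable_both P Q : measurable [set x | P x] -> measurable [set x | Q x] ->
  measurable [set x | P x /\ Q x].
Proof. exact: measurableI. Qed.

Lemma measurable_cstP (P : Prop) : measurable [set x : T | P].
Proof.
have [p|p] := pselect P.
  by rewrite (_ : [set x : T | P] = setT)//; apply/seteqP; split.
by rewrite (_ : [set x : T | P] = set0)//; apply/seteqP; split.
Qed.

Lemma measurable_imply P Q : measurable [set x | P x] -> measurable [set x | Q x] ->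
  measurable [set x | P x -> Q x].
Proof.
move=> mP mQ; rewrite [X in measurable X](_ : _ = ~` [set x | P x] `|` [set x | Q x]).
  by apply: measurableU => //; exact: measurableC.
apply/seteqP; split=> x /=; last by case.
by move=> PQ; have [/PQ|] := pselect (P x); [right|left].
Qed.

Lemma measurable_all (I : Type) (s : seq I) (p : I -> T -> bool) :
  (forall i, measurable [set x | p i x]) -> measurable [set x | all (p^~ x) s].
Proof.
move=> mp; elim: s => [|i s IHs]; first exact: (measurable_cstP true).
rewrite [X in measurable X](_ : _ = [set x | p i x /\ all (p^~ x) s]).
  exact: measurable_both.
by apply/seteqP; split=> x /=; [move/andP|move=> ?; apply/andP].
Qed.

Variable R : realType.

Lemma freq_indic (U : nat -> set T) n x :
  freq R (fun j => U j x) n = (\sum_(j < n) \1_(U j) x) / n%:R.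
Proof.
by rewrite /freq /count_below natr_sum; congr (_ / _).
Qed.

Lemma measurable_freq (U : nat -> set T) n : (forall j, measurable (U j)) ->
  measurable_fun setT (fun x => freq R (fun j => U j x) n).
Proof.
move=> mU; rewrite (_ : (fun x => _) = fun x => (\sum_(j < n) \1_(U j) x) / n%:R).
  apply: measurable_funM; last exact: measurable_cst.
  by apply: measurable_sum => j; exact: measurable_indic.
by apply/funext => x; rewrite freq_indic.
Qed.

Lemma measurable_freq_le (U : nat -> T -> Prop) n (r : R) :
  (forall j, measurable [set x | U j x]) ->
  measurable [set x | freq R (fun j => U j x) n <= r].
Proof.
move=> mU; have mf := @measurable_freq (fun j => [set x | U j x]) n mU.
rewrite [X in measurable X](_ : _ = setT `&`
    (fun x => freq R (fun j => U j x) n) @^-1` `]-oo, r]%classic).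
  exact: mf.
by rewrite setTI; apply/seteqP; split=> x /=; rewrite in_itv.
Qed.

End MeasurablePredicates.

Lemma FinN_enum : exists e : nat -> FinN, forall g, exists n, e n = g.
Proof.
pose code (g : FinN) := [seq g i | i <- iota 0 (sval (FinN_bound g))].
have code_inj g h : code g = code h -> g = h.
  rewrite /code; case: FinN_bound => m gm; case: FinN_bound => n hn /= E.
  have mn : m = n by have := congr1 size E; rewrite !size_map !size_iota.
  subst n; apply: FinN_ext => i; have [mi|im] := leqP m i; first by rewrite gm ?hn.
  have := congr1 (nth 0%N ^~ i) E.
  by rewrite !(nth_map 0%N) ?size_iota// !nth_iota.
exists (fun n => xget 1%g [set g | pickle (code g) = n]) => g.
exists (pickle (code g)); case: xgetP => [h _ /= /(pcan_inj pickleK)|/(_ g)/(_ erefl)//].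
exact: code_inj.
Qed.

Lemma mem_open (g : FinN) (b : bool) : @open (Defs.Sub FinN) [set H | val H g = b].
Proof.
exists (fun f : prod_topology (fun _ : FinN => bool) => f g = b) => //.
rewrite openE => f fg; have /cvg_sup/(_ g) : nbhs f --> f by exact: cvg_id.
apply; exists (fun f : FinN -> bool => f g = b); split=> //.
by exists [set b] => //; exact: discrete_open.
Qed.

Section Generation.
Variable e : nat -> FinN.
Hypothesis eP : forall g, exists n, e n = g.

Lemma open_nbhs_pattern (O : set (Defs.Sub FinN)) (H : Defs.Sub FinN) : open O -> O H ->
  exists N, forall K : Defs.Sub FinN,
    (forall n, (n < N)%N -> val K (e n) = val H (e n)) -> O K.
Proof.
move=> [W oW <-] WH; apply: contrapT => /forallNP noN.
have {noN} /choice[K KP] : forall N, exists K : Defs.Sub FinN,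
    (forall n, (n < N)%N -> val K (e n) = val H (e n)) /\ ~ W (set_val K).
  by move=> N; have /existsNP[K /not_implyP[? ?]] := noN N; exists K.
have : (fun N => set_val (K N)) @ \oo --> (set_val H : prod_topology (fun _ : FinN => bool)).
  apply/cvg_sup => g B [_ [[C oC <-] CH CB]]; have [n ng] := eP g.
  exists n.+1 => // N /= nN; apply: CB => /=; rewrite -ng.
  by have := (KP N).1 n nN; rewrite set_valE => ->; rewrite ng.
move=> /(_ W) []; first exact: open_nbhs_nbhs.
by move=> N _ /(_ N (leqnn N)) /= ; case: (KP N).
Qed.

End Generation.

Local Notation Subgroup := (BorelSub FinN).

Definition contains (F : seq FinN) : set Subgroup := [set H | all (val H) F].

Definition contains_sets : set (set (BorelSub FinN)) := range contains.

Lemma measurable_mem (g : FinN) : measurable [set H : Subgroup | val H g].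
Proof. by apply: sub_sigma_algebra; exact: mem_open. Qed.

Lemma measurable_contains F : measurable (contains F).
Proof. exact: (measurable_all F measurable_mem). Qed.

Lemma contains_setI : setI_closed contains_sets.
Proof.
move=> _ _ [F _ <-] [F' _ <-]; exists (F ++ F') => //.
by apply/seteqP; split=> H; rewrite /contains /= all_cat => /andP.
Qed.

(** Sub is second countable: an open set is a countable union of sets of
   subgroups prescribed on finitely many elements. *)
Lemma BorelSub_generated : @measurable _ Subgroup = <<s contains_sets >>.
Proof.
apply/seteqP; split; last first.
  apply: smallest_sub; first exact: sigma_algebra_measurable.
  by move=> _ [F _ <-]; exact: measurable_contains.
apply: smallest_sub; first exact: smallest_sigma_algebra.
move=> O oO; have [e eP] := FinN_enum.
pose T := g_sigma_algebraType contains_sets.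
suff : @measurable _ T O by [].
pose D (s : seq bool) : set T :=
  [set K | all (fun n => val K (e n) == nth true s n) (iota 0 (size s))].
pose F s : set T := if `[< D s `<=` O >] then D s else set0.
have -> : O = \bigcup_s F s.
  apply/seteqP; split=> [H OH|H [s _]]; last first.
    by rewrite /F; case: asboolP => // DO /DO.
  have [N HN] := open_nbhs_pattern eP oO OH.
  have sE n : (n < N)%N -> nth true (mkseq (fun n => val H (e n)) N) n = val H (e n).
    exact: nth_mkseq.
  exists (mkseq (fun n => val H (e n)) N) => //; rewrite /F; case: asboolP => [_|[]].
    by apply/allP => n; rewrite size_mkseq mem_iota => /andP[_ nN]; rewrite sE.
  move=> K /allP KH; apply: HN => n nN; rewrite -sE//; apply/eqP/KH.
  by rewrite size_mkseq mem_iota.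
apply: countable_bigcupT_measurable; first exact: countableP.
move=> s; rewrite /F; case: asboolP => // _.
apply: (@measurable_all _ T _ (iota 0 (size s)) (fun n K => val K (e n) == nth true s n)).
move=> n; have mn : measurable [set K : T | val K (e n)].
  rewrite [X in measurable X](_ : _ = contains [:: e n]).
    by apply: sub_sigma_algebra; exists [:: e n].
  by apply/seteqP; split=> K; rewrite /contains /= andbT.
case: (nth _ _ _); first by under eq_set do rewrite eqb_id.
rewrite [X in measurable X](_ : _ = [set K : T | ~ val K (e n)]); first exact: measurableC.
by apply/seteqP; split=> K /=; rewrite eqbF_neg => /negP.
Qed.

(** * A law of large numbers for exchangeable events *)

Section Probability.
Context d (T : measurableType d) (R : realType) (P : probability T R).

Definition unit_valued (f : T -> R) := forall x, 0 <= f x <= 1.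

Lemma unit_integrable (f : T -> R) : measurable_fun setT f -> unit_valued f ->
  P.-integrable setT (EFin \o f).
Proof.
move=> mf f01; apply: (@le_integrable _ _ _ _ _ _ _ (EFin \o cst 1)) => //.
- exact/measurable_EFinP.
- move=> x _ /=; have /andP[f0 f1] := f01 x.
  by rewrite lee_fin !ger0_norm.
- exact: finite_measure_integrable_cst.
Qed.

Lemma bounded_convergence (f : nat -> T -> R) (g : T -> R) :
  (forall n, measurable_fun setT (f n)) -> (forall n, unit_valued (f n)) ->
  measurable_fun setT g ->
  {ae P, forall x, f n x @[n --> \oo] --> g x} ->
  (\int[P]_x (f n x)%:E)%E @[n --> \oo] --> (\int[P]_x (g x)%:E)%E.
Proof.
move=> mf f01 mg fg.
have [//|||||_ _] := @dominated_convergence _ _ _ P setT measurableT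
   (fun n x => (f n x)%:E) (fun x => (g x)%:E) (EFin \o cst 1).
- by move=> n; exact/measurable_EFinP.
- exact/measurable_EFinP.
- apply: filterS fg => x fgx _; apply: cvg_EFin => //.
  exact: nearW.
- exact: finite_measure_integrable_cst.
- apply: aeW => x n _ /=; have /andP[f0 f1] := f01 n x.
  by rewrite lee_fin ger0_norm.
- exact.
Qed.

Lemma integral_comb (I : Type) (s : seq I) (c : I -> R) (A : I -> set T) :
  (forall i, measurable (A i)) ->
  P.-integrable setT (fun x => (\sum_(i <- s) c i * \1_(A i) x)%:E) /\
  (\int[P]_x (\sum_(i <- s) c i * \1_(A i) x)%:E = (\sum_(i <- s) c i * fine (P (A i)))%:E)%E.
Proof.
move=> mA; elim: s => [|i s [IH1 IH2]].
  split; last by under eq_integral do rewrite big_nil; rewrite integral0 big_nil.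
  under eq_fun do rewrite big_nil; exact: integrable0.
have E : (fun x => (\sum_(i <- i :: s) c i * \1_(A i) x)%:E) =
   (fun x => ((c i)%:E * (\1_(A i) x)%:E)%E) \+ (fun x => (\sum_(i <- s) c i * \1_(A i) x)%:E).
  by apply/funext => x; rewrite big_cons /= EFinD EFinM.
have Ii : P.-integrable setT (fun x => ((c i)%:E * (\1_(A i) x)%:E)%E).
  by apply: integrableZl => //; exact: integrable_indic.
rewrite E; split; first exact: integrableD.
rewrite integralD// IH2 integralZl ?integral_indic//; last exact: integrable_indic.
by rewrite setIT big_cons EFinD EFinM fineK// fin_num_measure.
Qed.

Lemma integral_comb_sqr (n : nat) (c : 'I_n -> R) (A : 'I_n -> set T) :
  (forall i, measurable (A i)) ->
  (\int[P]_x ((\sum_i c i * \1_(A i) x) ^+ 2)%:E =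
   (\sum_i \sum_j c i * c j * fine (P (A i `&` A j)))%:E)%E.
Proof.
move=> mA; rewrite pair_bigA /=.
have [_ <-] := @integral_comb _ (index_enum _) (fun ij : 'I_n * 'I_n => c ij.1 * c ij.2)
  (fun ij => A ij.1 `&` A ij.2) (fun ij => measurableI _ _ (mA ij.1) (mA ij.2)).
apply: eq_integral => x _; congr EFin.
rewrite expr2 big_distrl /=.
under eq_bigr do rewrite big_distrr /=.
rewrite pair_bigA /=; apply: eq_bigr => ij _.
by rewrite indicI /= mulrACA.
Qed.

Lemma sum_inv_sqr_le2 (n : nat) : \sum_(k < n) (k.+1%:R ^+ 2)^-1 <= 2 :> R.
Proof.
case: n => [|n]; first by rewrite big_ord0.
suff : \sum_(k < n.+1) (k.+1%:R ^+ 2)^-1 <= 2 - n.+1%:R^-1 :> R.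
  by move=> /le_trans; apply; rewrite gerBl invr_ge0.
elim: n => [|n IHn]; first by rewrite big_ord1 expr1n invr1; lra.
rewrite big_ord_recr /=; apply: (le_trans (lerD IHn (lexx _))).
rewrite -addrA lerD2l -lerBrDl opprK addrC.
have n1 : 0 < n.+1%:R :> R by [].
have n2 : 0 < n.+2%:R :> R by [].
have -> : n.+1%:R^-1 - n.+2%:R^-1 = (n.+1%:R * n.+2%:R)^-1 :> R.
  apply: (mulIf (lt0r_neq0 n2)); rewrite mulrBl mulVf ?gt_eqF//.
  rewrite invfM mulfVK ?gt_eqF// -[n.+2%:R]natr1 mulrDr mulVf ?gt_eqF// mulr1.
  by rewrite addrC addKr.
by rewrite lef_pV2 ?posrE ?mulr_gt0 ?exprn_gt0// expr2 ler_wpM2r// ler_nat.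
Qed.

(** The functions k^2 g_k^2 still have a summable sequence of integrals, hence
   are summable almost everywhere, and |g_k| is at most k^2 g_k^2 + k^-2 by the
   inequality of the arithmetic and geometric means. *)
Lemma ae_summable (g : nat -> T -> R) :
  (forall k, measurable_fun setT (g k)) ->
  (forall k, (\int[P]_x ((g k x) ^+ 2)%:E <= ((k.+1%:R ^+ 4)^-1)%:E)%E) ->
  {ae P, forall x, cvgn (series (fun k => `|g k x|))}.
Proof.
move=> mg g2.
pose h k x := (k.+1%:R ^+ 2 * (g k x) ^+ 2 : R).
have h0 k x : 0 <= h k x by rewrite mulr_ge0 ?sqr_ge0.
have mh k : measurable_fun setT (EFin \o h k).
  apply/measurable_EFinP; apply: measurable_funM => //.
  exact: measurable_funX.
have hI k : (\int[P]_x (h k x)%:E <= ((k.+1%:R ^+ 2)^-1)%:E)%E.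
  rewrite /h; under eq_integral do rewrite EFinM.
  rewrite ge0_integralZl//; last 2 first.
  - by apply/measurable_EFinP; exact: measurable_funX.
  - by move=> x _; rewrite lee_fin sqr_ge0.
  apply: (le_trans (lee_wpmul2l _ (g2 k))); first by rewrite lee_fin exprn_ge0.
  rewrite -EFinM lee_fin -[4%N]/(2 + 2)%N exprD invfM mulVKf// expf_neq0//.
have hfin : (\int[P]_x (\sum_(0 <= k <oo) (h k x)%:E) <= 2%:E)%E.
  rewrite integral_nneseries//; last by move=> k x _; rewrite lee_fin.
  apply: lime_le.
    by apply: is_cvg_nneseries => k _ _; apply: integral_ge0 => x _; rewrite lee_fin.
  apply: nearW => n; rewrite big_mkord.
  apply: (@le_trans _ _ (\sum_(k < n) ((k.+1%:R ^+ 2)^-1)%:E)%E); first exact: lee_sum.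
  by rewrite sumEFin lee_fin sum_inv_sqr_le2.
have hint : P.-integrable setT (fun x => \sum_(0 <= k <oo) (h k x)%:E)%E.
  apply/integrableP; split.
    apply: ge0_emeasurable_sum; first by move=> *; rewrite lee_fin.
    by move=> k _; exact: mh.
  rewrite (eq_integral (fun x => \sum_(0 <= k <oo) (h k x)%:E)%E).
    by apply: le_lt_trans hfin _; rewrite ltry.
  by move=> x _; rewrite gee0_abs// nneseries_ge0// => k _ _; rewrite lee_fin.
apply: filterS (integrable_ae measurableT hint) => x /(_ Logic.I) hx.
apply: nondecreasing_is_cvgn.
  by apply: nondecreasing_series => k _ _.
exists (fine (\sum_(0 <= k <oo) (h k x)%:E)%E + 2) => _ [n _ <-].
rewrite /series /= big_mkord.
apply: (@le_trans _ _ (\sum_(k < n) (h k x + (k.+1%:R ^+ 2)^-1))).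
  apply: ler_sum => k _; rewrite /h.
  have k0 : 0 < k.+1%:R :> R by [].
  set a := k.+1%:R; set b := `|g k x|.
  have -> : g k x ^+ 2 = b ^+ 2 by rewrite /b real_normK// num_real.
  have b0 : 0 <= b by rewrite /b.
  have : 0 <= (a * b - a^-1) ^+ 2 by exact: sqr_ge0.
  rewrite sqrrB (_ : a * b / a = b); last by rewrite mulrAC divff ?mul1r// gt_eqF.
  rewrite exprMn exprVn mulr2n; move: (a ^+ 2 * b ^+ 2) (a ^- 2) => u v. lra.
rewrite big_split/=; apply: lerD; last exact: sum_inv_sqr_le2.
rewrite -lee_fin fineK// -sumEFin.
have := @nneseries_lim_ge R (fun k => (h k x)%:E) xpredT 0 n.
by rewrite big_mkord; apply => k _ _; rewrite lee_fin.
Qed.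

(** If all events X_j have probability q and all intersections of two of them
   have probability p, then the squared distance in L2 of the averages of the
   indicators of the first m and n events is (q - p)(1/m - 1/n). *)
Section Exchangeable.
Variables (X : nat -> set T) (q p : R).
Hypothesis mX : forall j, measurable (X j).
Hypothesis Xq : forall j, P (X j) = q%:E.
Hypothesis Xp : forall i j, i <> j -> P (X i `&` X j) = p%:E.

Let pq : p <= q.
Proof.
rewrite -lee_fin -(@Xp 0 1)// -(Xq 0); apply: le_measure; rewrite ?inE//.
exact: measurableI.
Qed.

Let p0 : 0 <= p.
Proof. by rewrite -lee_fin -(@Xp 0 1)//. Qed.

Let q1 : q <= 1.
Proof. by rewrite -lee_fin -(Xq 0); exact: probability_le1. Qed.

Let freqX n x : R := freq R (fun j => X j x) n.

Let measurable_freqX n : measurable_fun setT (freqX n).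
Proof. exact: measurable_freq. Qed.

Let second_moment n (c : nat -> R) :
  (\int[P]_x ((\sum_(j < n) c j * \1_(X j) x) ^+ 2)%:E =
   (p * (\sum_(j < n) c j) ^+ 2 + (q - p) * \sum_(j < n) c j ^+ 2)%:E)%E.
Proof.
rewrite integral_comb_sqr//; congr EFin.
rewrite expr2 big_distrl mulr_sumr mulr_sumr -big_split; apply: eq_bigr => i _ /=.
rewrite (bigD1 i)//= [in RHS](bigD1 i)//= setIid Xq /=.
rewrite (_ : \sum_(j < n | j != i) _ = c i * p * \sum_(j < n | j != i) c j); last first.
  rewrite mulr_sumr; apply: eq_bigr => j ji; rewrite Xp 1?mulrAC//.
  by move=> /val_inj ij; rewrite ij eqxx in ji.
by move: (\sum_(_ < _ | _) _) => S; rewrite expr2; lra.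
Qed.

Let freqX_sum n x N : (n <= N)%N ->
  freqX n x = \sum_(j < N) ((j < n)%N%:R / n%:R) * \1_(X j) x.
Proof.
move=> nN; rewrite /freqX freq_indic mulr_suml.
rewrite (big_ord_widen N (fun j => \1_(X j) x / n%:R) nN) big_mkcond.
by apply: eq_bigr => j _; case: ifP => _; rewrite ?mul0r// mul1r mulrC.
Qed.

Let freqX_dist2 m n : (0 < m <= n)%N ->
  (\int[P]_x ((freqX n x - freqX m x) ^+ 2)%:E <= (m%:R^-1)%:E)%E.
Proof.
move=> /andP[m0 mn]; have n0 : (0 < n)%N := leq_trans m0 mn.
have mR : 0 < m%:R :> R by rewrite ltr0n.
have nR : 0 < n%:R :> R by rewrite ltr0n.
pose c j : R := (j < n)%N%:R / n%:R - (j < m)%N%:R / m%:R.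
under eq_integral => x _.
  rewrite (_ : freqX n x - freqX m x = \sum_(j < n) c j * \1_(X j) x); first over.
  rewrite (freqX_sum x (leqnn n)) (freqX_sum x mn) -sumrB.
  by apply: eq_bigr => j _; rewrite -mulrBl.
have sum1 k : (0 < k <= n)%N -> \sum_(j < n) (j < k)%N%:R / k%:R = 1 :> R.
  move=> /andP[k0 kn]; rewrite -mulr_suml -natr_sum.
  rewrite -(big_mkcond _ (fun=> 1%N)) /= -(big_ord_widen n (fun=> 1%N) kn) sum1_card card_ord.
  by rewrite divff// pnatr_eq0 -lt0n.
rewrite second_moment lee_fin.
have sn := sum1 n; rewrite n0 leqnn in sn; move: sn => /(_ isT) sn.
have sm := sum1 m; rewrite m0 mn in sm; move: sm => /(_ isT) sm.
have c0 : \sum_(j < n) c j = 0 by rewrite /c sumrB sn sm subrr.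
have c2 : \sum_(j < n) c j ^+ 2 = m%:R^-1 - n%:R^-1.
  rewrite (eq_bigr (fun j : 'I_n => (m%:R^-1 - 2 * n%:R^-1) * ((j < m)%N%:R / m%:R)
    + n%:R^-1 * ((j < n)%N%:R / n%:R))); last first.
    by move=> j _; rewrite /c ltn_ord expr2; case: (j < m)%N; rewrite /=; lra.
  by rewrite big_split/= -!mulr_sumr sn sm; lra.
rewrite c0 expr0n mulr0 add0r c2.
have nm : n%:R^-1 <= m%:R^-1 :> R by rewrite lef_pV2 ?posrE// ler_nat.
have nV : 0 <= n%:R^-1 :> R by rewrite invr_ge0.
have := pq; have := p0; have := q1.
by move: (n%:R^-1) (m%:R^-1) nm nV => u v *; nra.
Qed.

Lemma exchangeable_freq_cvg :
  {ae P, forall x, cvgn (freq R (fun j => X j x))}.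
Proof.
pose g k x := freqX (k.+2 ^ 4)%N x - freqX (k.+1 ^ 4)%N x.
have mg k : measurable_fun setT (g k) by apply: measurable_funB.
have g2 k : (\int[P]_x ((g k x) ^+ 2)%:E <= ((k.+1%:R ^+ 4)^-1)%:E)%E.
  rewrite -natrX; apply: freqX_dist2; rewrite expn_gt0/=.
  by rewrite leq_exp2r.
apply: filterS (ae_summable mg g2) => x gx.
have := @normed_cvg _ _ (fun k => g k x : R) gx.
rewrite (_ : series (fun k => g k x) = fun n => freqX (n.+1 ^ 4)%N x - freqX 1 x).
  move=> cg; suff : cvgn (fun k => freqX (k.+1 ^ 4)%N x).
    by move/cvg_ex => [l /freq_cvg_sub fl]; apply/cvg_ex; exists l.
  rewrite (_ : (fun k => _) = fun k => freqX (k.+1 ^ 4)%N x - freqX 1 x + freqX 1 x).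
    by apply: is_cvgD => //; exact: is_cvg_cst.
  by apply/funext => k; rewrite subrK.
apply/funext => n; rewrite /series /= (telescope_sumr (fun n => freqX (n.+1 ^ 4)%N x))//.
Qed.

(** For pairwise independent events the averages stay within 1/n of their mean
   q, in squared L2 distance. *)
Lemma independent_freq_cvg : p = q ^+ 2 ->
  {ae P, forall x, freq R (fun j => X j x) n @[n --> \oo] --> q}.
Proof.
move=> pqq; pose g k x := freqX (k.+1 ^ 4)%N x - q.
have mg k : measurable_fun setT (g k) by apply: measurable_funB.
have g2 k : (\int[P]_x ((g k x) ^+ 2)%:E <= ((k.+1%:R ^+ 4)^-1)%:E)%E.
  rewrite -natrX /g; set n := (k.+1 ^ 4)%N.
  have n0 : 0 < n%:R :> R by rewrite ltr0n expn_gt0.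
  (* The constant q is treated as the indicator of the whole space. *)
  pose c (i : 'I_n.+1) : R := if unlift ord0 i is Some j then n%:R^-1 else - q.
  pose Y (i : 'I_n.+1) := if unlift ord0 i is Some j then X j else setT.
  have mY i : measurable (Y i) by rewrite /Y; case: unlift.
  under eq_integral => x _.
    rewrite (_ : freqX n x - q = \sum_i c i * \1_(Y i) x); first over.
    rewrite big_ord_recl /c /Y unlift_none indicT mulr1 addrC; congr (_ + _).
    rewrite /freqX freq_indic mulr_suml; apply: eq_bigr => j _.
    by rewrite liftK mulrC.
  rewrite integral_comb_sqr// lee_fin.
  have PT : fine (P setT) = 1 by rewrite probability_setT.
  have E0 : \sum_j c ord0 * c j * fine (P (Y ord0 `&` Y j)) = q ^+ 2 - q ^+ 2.
    rewrite big_ord_recl /c /Y unlift_none setIT PT mulr1 mulrNN -expr2; congr (_ + _).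
    under eq_bigr do rewrite liftK setTI Xq/=.
    rewrite sumr_const card_ord -[(_ * q) *+ n]mulr_natr -!mulrA [q * n%:R]mulrC.
    by rewrite mulKf ?gt_eqF// mulNr.
  have SM : \sum_(i < n) \sum_(j < n) n%:R^-1 * n%:R^-1 * fine (P (X i `&` X j)) =
      p + (q - p) / n%:R.
    apply: EFin_inj; rewrite -(@integral_comb_sqr _ (fun=> n%:R^-1))//.
    rewrite (second_moment n (fun=> n%:R^-1)) !sumr_const !card_ord.
    rewrite -[n%:R^-1 *+ n]mulr_natr -[(_ ^+ 2) *+ n]mulr_natr.
    by rewrite mulVf ?gt_eqF// expr1n mulr1 expr2 -mulrA mulVf ?gt_eqF// mulr1.
  have E1 : \sum_(i < n) \sum_j c (lift ord0 i) * c j * fine (P (Y (lift ord0 i) `&` Y j)) =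
      p + (q - p) / n%:R - q ^+ 2.
    rewrite -SM (_ : - q ^+ 2 = \sum_(i < n) - (q ^+ 2) / n%:R); last first.
      by rewrite sumr_const card_ord -[(_ / _) *+ n]mulr_natr divfK ?gt_eqF.
    rewrite -big_split; apply: eq_bigr => i _; rewrite big_ord_recl addrC; congr (_ + _).
      by rewrite /c /Y; under eq_bigr do rewrite !liftK.
    rewrite /c /Y liftK unlift_none setIT Xq /=; lra.
  rewrite big_ord_recl E0 E1 subrr add0r pqq addrAC subrr add0r.
  rewrite ler_piMl ?invr_ge0//.
  have := p0; have := q1; rewrite pqq; lra.
apply: filterS (ae_summable mg g2) => x gx.
apply: freq_cvg_sub; apply/subr_cvg0; apply: norm_cvg0.
exact: cvg_series_cvg_0 gx.
Qed.

End Exchangeable.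

End Probability.

Section Probability2.
Context d (T : measurableType d) (R : realType) (P : probability T R).

Let fin01 (A : set T) : measurable A -> 0 <= fine (P A) <= 1.
Proof.
move=> mA; rewrite fine_ge0//= -lee_fin fineK ?fin_num_measure//.
exact: probability_le1.
Qed.

Lemma integral_freq (X : nat -> set T) n : (forall j, measurable (X j)) ->
  (\int[P]_x (freq R (fun j => X j x) n)%:E = ((\sum_(j < n) fine (P (X j))) / n%:R)%:E)%E.
Proof.
move=> mX; under eq_integral => x _.
  rewrite freq_indic mulr_suml.
  rewrite (_ : \sum_(j < n) _ = \sum_(j < n) n%:R^-1 * \1_(X j) x); first over.
  by apply: eq_bigr => j _; rewrite mulrC.
have [_ ->] := @integral_comb _ _ _ P _ (index_enum 'I_n) (fun=> n%:R^-1) X mX.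
by rewrite -mulr_sumr mulrC.
Qed.

Lemma freq_unit (U : nat -> set T) n : unit_valued (fun x => freq R (fun j => U j x) n).
Proof. by move=> x; rewrite freq_ge0 freq_le1. Qed.

(** A recurrence principle: the mean frequency of equally likely events is their
   common probability. *)
Lemma null_of_freq_cvg0 (Y : nat -> set T) N (p : \bar R) :
  (forall j, measurable (Y j)) ->
  (forall x, freq R (fun j => Y j x) n @[n --> \oo] --> (0 : R)) ->
  (forall j, (N <= j)%N -> P (Y j) = p) -> p = 0%E.
Proof.
move=> mY Y0 Yp.
have pE : p = (fine p)%:E by rewrite fineK// -(Yp N)// fin_num_measure.
have r0 : 0 <= fine p by rewrite -(Yp N)//; case/andP: (fin01 (mY N)).
move: r0; rewrite le_eqVlt => /predU1P[r0|r0]; first by rewrite pE -r0.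
have := @bounded_convergence _ _ _ P (fun n x => freq R (fun j => Y j x) n) (fun=> 0)
  (fun n => measurable_freq n mY) (freq_unit Y) (measurable_cst _) (aeW _ Y0).
under eq_fun do rewrite integral_freq//.
rewrite integral0 => /fine_cvg/= /cvgrPdist_lt/(_ (fine p / 2)).
rewrite divr_gt0// => /(_ isT)[M _ HM].
set n := (M + (2 * N).+1)%N.
have := HM n (leq_addr _ _); rewrite sub0r normrN ltNge => /negP[].
have n0 : 0 < n%:R :> R by rewrite ltr0n /n; lia.
apply: le_trans (ler_norm _); rewrite ler_pdivlMr//.
have Nn : (N <= n)%N by rewrite /n; lia.
have sum_ge k : fine p * (k - N)%:R <= \sum_(j < k) fine (P (Y j)).
  elim: k => [|k IHk]; first by rewrite sub0n mulr0 big_ord0.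
  rewrite big_ord_recr /=; have [Nk|kN] := leqP N k.
    by rewrite Yp// subSn// -natr1 mulrDr mulr1 lerD2r.
  rewrite (_ : (k.+1 - N)%N = (k - N)%N); last by lia.
  by apply: (le_trans IHk); rewrite lerDl; case/andP: (fin01 (mY k)).
apply: le_trans (sum_ge n); rewrite -mulrA; apply: ler_wpM2l; first exact: ltW.
have : (n <= 2 * (n - N))%N by rewrite /n; lia.
by rewrite -(ler_nat R) natrM; lra.
Qed.

Lemma measurable_eventually_freq_le (X : nat -> T -> Prop) (e : R) :
  (forall j, measurable [set x | X j x]) ->
  measurable [set x | exists N, forall n, (N <= n)%N -> freq R (fun j => X j x) n <= e].
Proof.
move=> mX; apply: measurable_exists => N; apply: measurable_forall => n.
apply: measurable_imply; first exact: measurable_cstP.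
exact: measurable_freq_le.
Qed.

Definition limsup (u : nat -> R) : R := fine (limn_esup (EFin \o u)).

Lemma cvg_limsup (u : nat -> R) (l : R) : u n @[n --> \oo] --> l -> limsup u = l.
Proof.
move=> ul; have ul' : (EFin \o u) n @[n --> \oo] --> l%:E.
  by apply: cvg_EFin => //; exact: nearW.
by rewrite /limsup (cvg_limn_einf_sup ul').2.
Qed.

Lemma limsup_unit (u : nat -> R) : (forall n, 0 <= u n <= 1) -> 0 <= limsup u <= 1.
Proof.
move=> u01.
suff /andP[h0 h1] : (0 <= limn_esup (EFin \o u) <= 1)%E.
  have fin : limn_esup (EFin \o u) \is a fin_num.
    by rewrite ge0_fin_numE//; apply: le_lt_trans h1 _; rewrite ltry.
  by rewrite /limsup -!lee_fin fineK// h0.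
rewrite limn_esup_lim; apply/andP; split.
- apply: lime_ge; first exact: is_cvg_esups.
  apply: nearW => n; apply: (@le_trans _ _ (u n)%:E).
    by rewrite lee_fin; case/andP: (u01 n).
  by apply: ereal_sup_ubound; exists n => /=.
- apply: lime_le; first exact: is_cvg_esups.
  apply: nearW => n; apply: ge_ereal_sup => _ [k _ <-].
  by rewrite lee_fin; case/andP: (u01 k).
Qed.

Lemma measurable_limsup (f : nat -> T -> R) : (forall n, measurable_fun setT (f n)) ->
  measurable_fun setT (fun x => limsup (f^~ x)).
Proof.
move=> mf; apply: measurableT_comp => //.
by apply: measurable_fun_limn_esup => n; exact/measurable_EFinP.
Qed.

Lemma integral_limsup (f : nat -> T -> R) (q : R) :
  (forall n, measurable_fun setT (f n)) -> (forall n, unit_valued (f n)) ->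
  {ae P, forall x, cvgn (f^~ x)} ->
  (\int[P]_x (f n x)%:E)%E @[n --> \oo] --> q%:E ->
  (\int[P]_x (limsup (f^~ x))%:E = q%:E)%E.
Proof.
move=> mf f01 cf fq.
have := @bounded_convergence _ _ _ P f _ mf f01 (measurable_limsup mf).
move=> /(_ _)/(cvg_unique _); apply => //.
by apply: filterS cf => x cx; rewrite (cvg_limsup cx).
Qed.

(** Markov's inequality for the limit of the frequencies, whose mean is q. *)
Lemma freq_large_le (X : nat -> set T) (q e : R) :
  (forall j, measurable (X j)) -> (forall j, P (X j) = q%:E) -> 0 < e ->
  {ae P, forall x, cvgn (freq R (fun j => X j x))} ->
  (e%:E * P [set x | ~ exists N, forall n, (N <= n)%N -> (freq R (fun j => X j x) n <= e)%R]
     <= q%:E)%E.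
Proof.
move=> mX Xq e0 cX; set B := [set x | ~ _].
have mB : measurable B.
  by apply: measurable_not; exact: measurable_eventually_freq_le.
pose f n x := freq R (fun j => X j x) n.
have mf n : measurable_fun setT (f n) by exact: measurable_freq.
have f01 n : unit_valued (f n) by exact: freq_unit.
have <- : (\int[P]_x (limsup (f^~ x))%:E = q%:E)%E.
  apply: integral_limsup => //; rewrite -(cvg_shiftS (fun n => \int[P]_x (f n x)%:E)%E).
  rewrite (_ : (fun n => _) = cst q%:E); first exact: cvg_cst.
  apply/funext => n; rewrite /f integral_freq//=.
  under eq_bigr do rewrite Xq.
  by rewrite sumr_const card_ord -[_ *+ _]mulr_natr mulfK.
rewrite -(setIT B) -integral_indic// -integralZl//; last exact: integrable_indic.
have limsup0 x : 0 <= limsup (f^~ x) by case/andP: (limsup_unit (f01 ^~ x)).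
apply: ae_ge0_le_integral => //.
- by move=> x _; rewrite mule_ge0// lee_fin ltW.
- by apply: emeasurable_funM => //; apply/measurable_EFinP; exact: measurable_indic.
- by move=> x _; rewrite lee_fin.
- by apply/measurable_EFinP; exact: measurable_limsup.
apply: filterS cX => x cx _; rewrite -EFinM lee_fin.
have [xB|xB] := boolP (x \in B); last by rewrite indicE (negbTE xB) mulr0.
rewrite indicE xB mulr1 (cvg_limsup cx) leNgt; apply/negP => le.
move: xB; rewrite inE => -[].
have [N _ HN] := cvgr_lt _ cx _ le.
by exists N => n Nn; apply/ltW/HN.
Qed.

(** A function that is almost surely on one side of its mean is constant. *)
Lemma ae_eq_mean (f : T -> R) (q : R) : measurable_fun setT f -> unit_valued f ->
  (\int[P]_x (f x)%:E = q%:E)%E ->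
  P [set x | f x < q] = 0%E \/ P [set x | f x < q] = 1%E ->
  {ae P, forall x, f x = q}.
Proof.
move=> mf f01 fq f_01.
have mlt : measurable [set x | f x < q].
  by rewrite -[X in measurable X]setTI; exact: measurable_fun_ltr.
have If : P.-integrable setT (EFin \o f) by exact: unit_integrable.
have Iq : P.-integrable setT (EFin \o cst q) by exact: finite_measure_integrable_cst.
have qI : (\int[P]_x q%:E = q%:E)%E.
  rewrite integral_cst//=; rewrite [X in (_ * X)%E]probability_setT mule1//.
have mfq : measurable_fun setT (fun x => (f x - q)%:E).
  by apply/measurable_EFinP; apply: measurable_funB.
suff : (\int[P]_x `|(f x - q)%:E| = 0)%E.
  move=> /(ae_eq_integral_abs P measurableT mfq).
  by apply: filterS => x /(_ Logic.I) [] /subr0_eq.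
case: f_01 => Plt.
- rewrite (@ae_eq_integral _ _ _ P setT (fun x => (f x - q)%:E))//.
  + under eq_integral do rewrite EFinB.
    by rewrite integralB_EFin// fq qI subee.
  + exact: measurableT_comp.
  + exists [set x | f x < q]; split=> // x /= /not_implyP[_ h].
    by rewrite ltNge; apply/negP => qf; apply: h; rewrite ger0_norm// subr_ge0.
- rewrite (@ae_eq_integral _ _ _ P setT (fun x => (q - f x)%:E))//.
  + under eq_integral do rewrite EFinB.
    by rewrite integralB_EFin// fq qI subee.
  + exact: measurableT_comp.
  + by apply/measurable_EFinP; apply: measurable_funB.
  + exists (~` [set x | f x < q]); split => //; first exact: measurableC.
      by have := probability_setC P mlt; rewrite Plt subee.
    move=> x /= /not_implyP[_ h] fx; apply: h.
    by rewrite ler0_norm ?opprB// subr_le0 ltW.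
Qed.

End Probability2.

(** * Almost sure properties of an invariant random subgroup *)

Lemma pair_move a b i j : a <> b -> i <> j -> exists g : FinN,
  [/\ g a = i, g b = j & forall n, n <> a -> n <> b -> n <> i -> n <> j -> g n = n].
Proof.
move=> ab ij; set u := swap a i b.
have iu : i <> u by rewrite /u => iu; apply: ab; apply: (@FinN_inj (swap a i)); rewrite swapL.
exists (swap u j * swap a i)%g; split.
- by rewrite FinN_mulE swapL swapD.
- by rewrite FinN_mulE -/u swapL.
- move=> n na nb ni nj; rewrite FinN_mulE (swapD na ni) swapD// => nu.
  by apply: nb; apply: (@FinN_inj (swap a i)); rewrite -/u swapD.
Qed.

Lemma conj_swap_fixed (g : FinN) x y : g x = x -> g y = y -> (g ^ swap x y)%g = g.
Proof.
move=> gx gy; apply: FinN_ext => n; rewrite conjgE swapV !FinN_mulE.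
have [->|/eqP nx] := eqVneq n x; first by rewrite swapL gy swapR.
have [->|/eqP ny] := eqVneq n y; first by rewrite swapR gx swapL.
rewrite (swapD nx ny) swapD// => gn; [apply: nx|apply: ny]; apply: (@FinN_inj g);
  by rewrite gn ?gx ?gy.
Qed.

Lemma fixes_aboveV (g : FinN) n : fixes_above g n -> fixes_above g^-1%g n.
Proof. by move=> gn m nm; apply: FinN_invE; exact: gn. Qed.

Definition orb (H : Subgroup) (x y : nat) : Prop := exists g, val H g /\ g x = y.

Lemma orb_refl H x : orb H x x.
Proof. by exists 1%g; split; first exact: Sub1. Qed.

Lemma orb_sym H x y : orb H x y -> orb H y x.
Proof. by move=> [g [Hg gx]]; exists g^-1%g; split; [exact: SubV|exact: FinN_invE]. Qed.

Lemma orb_trans H x y z : orb H x y -> orb H y z -> orb H x z.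
Proof.
move=> [g [Hg gx]] [h [Hh hy]]; exists (h * g)%g; split; first exact: SubM.
by rewrite FinN_mulE gx.
Qed.

Lemma orb_conj (g : FinN) H x y :
  orb (conj_subgroup g H) x y <-> orb H (g^-1%g x) (g^-1%g y).
Proof.
split=> [[h [/= Hh hx]]|[h [Hh hx]]].
  exists (h ^ g)%g; split=> //.
  by rewrite conjgE !FinN_mulE FinN_mulgV hx.
exists (h ^ g^-1)%g; split; first by rewrite /= conjgKV.
by rewrite conjgE invgK !FinN_mulE hx FinN_mulgV.
Qed.

Lemma measurable_orb x y : measurable [set H : Subgroup | orb H x y].
Proof.
have [e eP] := FinN_enum.
rewrite [X in measurable X](_ : _ = [set H : Subgroup | exists n, val H (e n) /\ e n x = y]).
  apply: measurable_exists => n.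
  apply: measurable_both.
    exact: (measurable_mem (e n)).
  exact: measurable_cstP.
apply/seteqP; split=> H /= [g [Hg gx]]; last by exists (e g).
by have [n ng] := eP g; exists n; rewrite ng.
Qed.

Section Dust.
Variable R : realType.
Implicit Types (H : Subgroup) (e : R).

Definition small e H x := exists N, forall n, (N <= n)%N -> freq R (orb H x) n <= e.

Definition dust H x := forall k, small k.+1%:R^-1 H x.

(** The points of the blocks of positive but small frequency: if these were not
   negligible, mass could escape to blocks with ever larger labels. *)
Definition sparse k H x := small k.+1%:R^-1 H x /\ ~ dust H x.

Lemma freq_orb_conj (g : FinN) H x n : fixes_above g n ->
  freq R (orb (conj_subgroup g H) x) n = freq R (orb H (g^-1%g x)) n.
Proof.
move=> gn; rewrite -(freq_perm R (orb H (g^-1%g x)) (fixes_aboveV gn)).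
by apply: freq_eq => j; exact: orb_conj.
Qed.

Lemma small_conj (g : FinN) e H x :
  small e (conj_subgroup g H) x <-> small e H (g^-1%g x).
Proof.
have [m gm] := FinN_bound g.
split=> -[N HN]; exists (maxn N m) => n; rewrite geq_max => /andP[Nn mn].
  by rewrite -(freq_orb_conj H x (fixes_above_leq mn gm)) HN.
by rewrite (freq_orb_conj H x (fixes_above_leq mn gm)) HN.
Qed.

Lemma dust_conj (g : FinN) H x : dust (conj_subgroup g H) x <-> dust H (g^-1%g x).
Proof. by split=> h k; apply/small_conj; exact: h. Qed.

Lemma sparse_conj (g : FinN) k H x :
  sparse k (conj_subgroup g H) x <-> sparse k H (g^-1%g x).
Proof. by rewrite /sparse small_conj dust_conj. Qed.

Lemma dust_cvg H x : dust H x -> freq R (orb H x) n @[n --> \oo] --> (0 : R).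
Proof.
move=> Hx; apply/cvgrPdist_le => e e0.
have [N HN] := Hx (Num.truncn e^-1).
exists N => // n /= /HN; rewrite sub0r normrN ger0_norm ?freq_ge0// => /le_trans; apply.
rewrite -[leRHS]invrK lef_pV2 ?posrE ?invr_gt0//.
by apply: ltW; exact: truncnS_gt.
Qed.

Lemma measurable_small e x : measurable [set H : Subgroup | small e H x].
Proof. exact: (measurable_eventually_freq_le e (measurable_orb x)). Qed.

Lemma measurable_dust x : measurable [set H : Subgroup | dust H x].
Proof. by apply: measurable_forall => k; exact: measurable_small. Qed.

Lemma measurable_sparse k x : measurable [set H : Subgroup | sparse k H x].
Proof.
apply: measurable_both; first exact: measurable_small.
by apply: measurable_not; exact: measurable_dust.
Qed.

End Dust.

Lemma freq_finite_cvg0 (R : realType) (U : nat -> Prop) N :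
  (forall j, (N <= j)%N -> ~ U j) -> freq R U n @[n --> \oo] --> (0 : R).
Proof.
move=> UN; apply: (@freq_shift _ _ N).
rewrite (_ : freq R _ = fun=> 0); first exact: cvg_cst.
apply/funext => n; rewrite /freq /count_below big1 ?mul0r// => j _.
by apply/eqP; rewrite eqb0; apply/asboolPn; apply: UN; exact: leq_addl.
Qed.

Section AlmostSure.
Variables (R : realType) (nu : probability Subgroup R).
Hypothesis nu_inv : is_IRS nu.

Lemma IRS_conj (g : FinN) (E E' : Subgroup -> Prop) :
  measurable [set H | E H] -> (forall H, E (conj_subgroup g H) <-> E' H) ->
  nu [set H | E' H] = nu [set H | E H].
Proof.
move=> mE EE'; rewrite -(nu_inv g mE); congr (nu _).
by apply/seteqP; split=> H /= /EE'.
Qed.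

Lemma ae_orb_freq_cvg x : {ae nu, forall H, cvgn (freq R (orb H x))}.
Proof.
(* The orbit always contains x itself, so only points above x are used. *)
pose X j : set Subgroup := [set H | orb H x (j + x.+1)%N].
have mX j : measurable (X j) by exact: measurable_orb.
have Xx j : (j + x.+1)%N <> x by lia.
have Xq j : nu (X j) = (fine (nu (X 0%N)))%:E.
  rewrite fineK ?fin_num_measure//.
  apply: (@IRS_conj (swap (0 + x.+1) (j + x.+1)) (fun H => orb H x (0 + x.+1)%N)
    (fun H => orb H x (j + x.+1)%N)); first exact: measurable_orb.
  move=> H; rewrite orb_conj swapV swapL swapD//; exact/nesym.
have Xp i j : i <> j -> nu (X i `&` X j) = (fine (nu (X 0%N `&` X 1%N)))%:E.
  move=> ij; rewrite fineK ?fin_num_measure//; last exact: measurableI.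
  have [|//|g [g0 g1 gD]] := @pair_move (i + x.+1) (j + x.+1) (0 + x.+1) (1 + x.+1).
    by move=> /addIn.
  apply: (@IRS_conj g (fun H => X 0%N H /\ X 1%N H) (fun H => X i H /\ X j H)).
    exact: measurableI.
  move=> H; rewrite /X /= !orb_conj (FinN_invE g0) (FinN_invE g1).
  by rewrite (@FinN_invE _ x x)//; apply: gD; exact/nesym.
apply: filterS (exchangeable_freq_cvg mX Xq Xp) => H /cvg_ex[l cl].
by apply/cvg_ex; exists l; exact: freq_shift cl.
Qed.

(** The points other than x are exchangeable, and if the orbit of x has frequency
   zero, then a vanishing proportion of them is in that orbit. *)
Lemma ae_dust_fixed x y : x <> y -> {ae nu, forall H, ~ (orb H x y /\ dust R H x)}.
Proof.
move=> xy; pose Y j := [set H : Subgroup | orb H x j /\ dust R H x].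
have mY j : measurable (Y j).
  by apply: measurable_both; [exact: measurable_orb|exact: measurable_dust].
suff Y0 : nu (Y y) = 0%E.
  by exists (Y y); split=> // H /= /contrapT.
apply: (@null_of_freq_cvg0 _ _ _ nu Y x.+1) => //.
- move=> H; have [Hx|Hx] := pselect (dust R H x).
    rewrite (_ : (fun j => Y j H) = orb H x); first exact: dust_cvg.
    by apply/funext => j; apply/propext; split=> [[]|].
  by apply: (@freq_finite_cvg0 _ _ 0%N) => j _ [].
- move=> j xj; have jx : j <> x by lia.
  apply: (@IRS_conj (swap y j) (fun H => orb H x y /\ dust R H x)
    (fun H => orb H x j /\ dust R H x)); first exact: mY.
  move=> H; rewrite orb_conj dust_conj swapV swapL swapD//; exact/nesym.
Qed.

(** By exchangeability x and the points outside the support of g are equally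
   likely to play the role of x in g. So almost surely, if x plays it then
   infinitely many of them do. *)
Lemma ae_recurrent (g : FinN) x : {ae nu, forall H : Subgroup, val H g ->
  forall N, exists2 y, (N <= y)%N & val H (g ^ swap x y)%g}.
Proof.
pose finite_ret (H : Subgroup) := exists N, forall y, (N <= y)%N -> ~ val H (g ^ swap x y)%g.
have mf : measurable [set H | finite_ret H].
  apply: measurable_exists => N; apply: measurable_forall => y.
  apply: measurable_imply; first exact: measurable_cstP.
  by apply: measurable_not; exact: (measurable_mem (g ^ swap x y)%g).
pose Y y := [set H : Subgroup | val H (g ^ swap x y)%g /\ finite_ret H].
have mY y : measurable (Y y).
  by apply: measurable_both => //; exact: (measurable_mem (g ^ swap x y)%g).
pose Z := [set H : Subgroup | val H g /\ finite_ret H].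
have mZ : measurable Z by apply: measurable_both => //; exact: (measurable_mem g).
suff Z0 : nu Z = 0%E.
  exists Z; split=> // H /= /not_implyP[Hg /existsNP[N /forall2NP HN]]; split=> //.
  by exists N => y Ny; case: (HN y).
have [m gm] := FinN_bound g.
apply: (@null_of_freq_cvg0 _ _ _ nu Y (maxn m x.+1)) => //.
- move=> H; have [[N HN]|Hx] := pselect (finite_ret H).
    by apply: (@freq_finite_cvg0 _ _ N) => j /HN h [].
  by apply: (@freq_finite_cvg0 _ _ 0%N) => j _ [].
- move=> y; rewrite geq_max => /andP[my xy].
  apply: (@IRS_conj (swap x y) (fun H => val H g /\ finite_ret H)
     (fun H => val H (g ^ swap x y)%g /\ finite_ret H)) => // H.
  have fE z : (maxn m y.+1 <= z)%N ->
      ((g ^ swap x z) ^ swap x y)%g = (g ^ swap x z)%g.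
    rewrite geq_max => /andP[mz yz]; apply: conj_swap_fixed.
      by rewrite conjgE swapV !FinN_mulE swapL gm// swapR.
    rewrite conjgE swapV !FinN_mulE [swap x z y]swapD; try lia.
    by rewrite gm// swapD//; lia.
  split=> -[Hg [N HN]]; split=> //; exists (maxn N (maxn m y.+1)) => z;
    rewrite geq_max => /andP[Nz mz].
  + by rewrite -fE//; exact: HN.
  + by rewrite /= fE//; exact: HN.
Qed.

(** By invariance the mean frequency of the sparse points is the probability
   that 0 is one of them, which tends to 0 as k grows. *)
Lemma ae_sparse_negligible : {ae nu, forall H, forall l, exists k N,
  forall n, (N <= n)%N -> freq R (sparse R k H) n <= l.+1%:R^-1}.
Proof.
have mS k j := measurable_sparse R k j.
pose q k := fine (nu [set H | sparse R k H 0%N]).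
have Xq k j : nu [set H | sparse R k H j] = (q k)%:E.
  rewrite fineK ?fin_num_measure//.
  apply: (@IRS_conj (swap 0 j) (fun H => sparse R k H 0) (fun H => sparse R k H j)) => //.
  by move=> H; rewrite sparse_conj swapV swapL.
have cX k : {ae nu, forall H, cvgn (freq R (sparse R k H))}.
  apply: (@exchangeable_freq_cvg _ _ _ nu (fun j => [set H | sparse R k H j]) (q k)
    (fine (nu ([set H | sparse R k H 0%N] `&` [set H | sparse R k H 1%N])))) => //.
  move=> i j ij; rewrite fineK ?fin_num_measure//; last exact: measurableI.
  have [//|//|g [g0 g1 gD]] := @pair_move i j 0 1.
  apply: (@IRS_conj g (fun H => sparse R k H 0%N /\ sparse R k H 1%N)
    (fun H => sparse R k H i /\ sparse R k H j)).
    exact: (measurableI _ _ (mS k 0%N) (mS k 1%N)).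
  by move=> H; rewrite !sparse_conj (FinN_invE g0) (FinN_invE g1).
have q0 : q k @[k --> \oo] --> (0 : R).
  have := @nonincreasing_cvg_mu _ _ _ nu (fun k => [set H | sparse R k H 0%N]).
  rewrite (_ : \bigcap_n _ = set0); last first.
    rewrite -subset0 => H HS; have [_ nd] := HS 0%N Logic.I.
    by apply: nd => k; have [] := HS k Logic.I.
  rewrite measure0 => h; apply: fine_cvg; apply: h => //.
  - by rewrite ltey_eq fin_num_measure.
  - move=> m n mn; apply/subsetPset => H /= [[N HN] nd]; split=> //; exists N => i /HN.
    by move=> /le_trans; apply; rewrite lef_pV2 ?posrE// ler_nat.
pose B k l := [set H | ~ exists N, forall n, (N <= n)%N -> freq R (sparse R k H) n <= l.+1%:R^-1].
have mB k l : measurable (B k l).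
  by apply: measurable_not; exact: (measurable_eventually_freq_le _ (mS k)).
apply: ae_foralln => l; exists (\bigcap_k B k l); split.
- exact: bigcapT_measurable.
- have BI k : (nu (\bigcap_k B k l) <= (l.+1%:R * q k)%:E)%E.
    apply: (@le_trans _ _ (nu (B k l))).
      by apply: le_measure; rewrite ?inE//; [exact: bigcapT_measurable|exact: bigcap_inf].
    have := @freq_large_le _ _ _ nu (fun j => [set H | sparse R k H j]) (q k) l.+1%:R^-1
      (mS k) (Xq k) _ (cX k).
    rewrite invr_gt0 ltr0n => /(_ isT); rewrite -/(B k l).
    by rewrite EFinM lee_pdivrMl.
  have mI : measurable (\bigcap_k B k l) by exact: bigcapT_measurable.
  apply/eqP; rewrite eq_le measure_ge0 andbT.
  rewrite -[X in (X <= _)%E]fineK ?fin_num_measure// lee_fin.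
  have cl : l.+1%:R * q k @[k --> \oo] --> (l.+1%:R * 0 : R) by apply: cvgMr.
  rewrite mulr0 in cl; apply: (ler_cvg_to (cvg_cst _) cl); apply: nearW => k.
  by rewrite -lee_fin fineK ?fin_num_measure.
- move=> H /= /forallNP h k _; exact: h.
Qed.

End AlmostSure.

(** * The blocks of a typical subgroup *)

Section DecreasingRearrangement.
Variables (R : realType) (f : nat -> R).
Hypothesis f0 : forall y, 0 <= f y.
Hypothesis f1 : forall n, \sum_(y < n) f y <= 1.

Let prec y z := (f z < f y) || ((f y == f z) && (y < z)%N).

Let prec_trans y x z : prec x y -> prec y z -> prec x z.
Proof.
rewrite /prec => /orP[xy|/andP[/eqP xy xy']] /orP[yz|/andP[/eqP yz yz']].
- by rewrite (lt_trans yz xy).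
- by rewrite -yz xy.
- by rewrite xy yz.
- by rewrite xy yz eqxx (ltn_trans xy' yz') orbT.
Qed.

Let prec_irr x : prec x x = false.
Proof. by rewrite /prec ltxx ltnn andbF. Qed.

Let prec_total x y : x != y -> prec x y || prec y x.
Proof.
by rewrite /prec neq_ltn; case: (ltgtP (f x) (f y)) => //= _ /orP[->|->]; rewrite ?orbT.
Qed.

Let bound_ex z : exists B, 0 < f z -> forall y, (B <= y)%N -> ~~ prec y z.
Proof.
have [fz|] := pselect (0 < f z); last by exists 0%N.
have cf : cvgn (series f).
  apply: nondecreasing_is_cvgn; first exact: nondecreasing_series.
  by exists 1 => _ [n _ <-]; rewrite /series /= big_mkord.
have [N _ HN] := cvgr_lt _ (cvg_series_cvg_0 cf) _ fz.
exists N => _ y Ny; have yz := HN y Ny.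
by rewrite /prec negb_or -leNgt (ltW yz) /= lt_eqF.
Qed.

Let bound z := sval (cid (bound_ex z)).

Let boundP z y : 0 < f z -> prec y z -> (y < bound z)%N.
Proof.
rewrite /bound; case: cid => B /= HB fz yz; rewrite ltnNge; apply/negP => By.
by have /negP := HB fz y By.
Qed.

Let rank z := (\sum_(y < bound z) prec y z)%N.

Let rankE z n : 0 < f z -> (bound z <= n)%N -> rank z = (\sum_(y < n) prec y z)%N.
Proof.
move=> fz Bn; rewrite /rank.
rewrite (@big_ord_widen _ 0%N addn _ n (fun y => nat_of_bool (prec y z)) Bn) big_mkcond.
apply: eq_bigr => y _; case: ltnP => // By.
by case: (boolP (prec y z)) => // /(boundP fz); rewrite ltnNge By.
Qed.

Let rank_lt y z : 0 < f y -> 0 < f z -> prec y z -> (rank y < rank z)%N.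
Proof.
move=> fy fz yz; pose n := maxn (bound y) (bound z).
rewrite (rankE fy (leq_maxl _ _ : (_ <= n)%N)) (rankE fz (leq_maxr _ _ : (_ <= n)%N)).
have yn : (y < n)%N by apply: leq_trans (boundP fz yz) _; exact: leq_maxr.
rewrite (bigD1 (Ordinal yn))//= [ltnRHS](bigD1 (Ordinal yn))//= prec_irr yz.
rewrite add0n add1n ltnS; apply: leq_sum => i _.
by case: (boolP (prec i y)) => // /prec_trans/(_ yz) ->.
Qed.

Let rank_inj y z : 0 < f y -> 0 < f z -> rank y = rank z -> y = z.
Proof.
move=> fy fz yz; apply/eqP; apply: contraT => /prec_total/orP[] /rank_lt.
  by rewrite yz ltnn => /(_ fy fz).
by rewrite yz ltnn => /(_ fz fy).
Qed.

Let rank_below z i : 0 < f z -> (i < rank z)%N -> exists y, [/\ prec y z, 0 < f y & rank y = i].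
Proof.
move=> fz iz; pose L := [seq y <- iota 0 (bound z) | prec y z].
have prec_pos y : prec y z -> 0 < f y.
  by rewrite /prec => /orP[/(lt_trans fz)//|/andP[/eqP -> _]].
have sizeL : size L = rank z.
  rewrite size_filter /rank -(@big_mkord _ 0%N addn _ xpredT (fun y => nat_of_bool (prec y z))).
  by rewrite /index_iota subn0 -sum1_count big_mkcond.
have uL : uniq (map rank L).
  rewrite map_inj_in_uniq ?filter_uniq ?iota_uniq// => x y.
  by rewrite !mem_filter => /andP[/prec_pos fx _] /andP[/prec_pos fy _]; exact: rank_inj.
have sL : {subset map rank L <= iota 0 (rank z)}.
  move=> _ /mapP[y + ->]; rewrite mem_filter => /andP[yz _].
  by rewrite mem_iota; apply: rank_lt => //; exact: prec_pos.
have [|_ LE] := uniq_min_size uL sL; first by rewrite size_iota size_map sizeL.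
have : i \in map rank L by rewrite LE mem_iota.
move=> /mapP[y]; rewrite mem_filter => /andP[yz _] ->.
by exists y; split=> //; exact: prec_pos.
Qed.

(** The values are listed in decreasing order, ties being broken by the index;
   finitely many indices precede a given one because the values are summable. *)
Lemma decreasing_rearrangement : exists (a : nat -> R) (r : nat -> nat),
  [/\ forall i, 0 <= a i, forall i, a i.+1 <= a i, forall y, 0 < f y -> a (r y) = f y,
      forall y z, 0 < f y -> 0 < f z -> r y = r z -> y = z &
      forall i, 0 < a i -> exists2 y, 0 < f y & r y = i].
Proof.
pose a i := if pselect (exists2 y, 0 < f y & rank y = i) is left h
  then f (sval (cid2 h)) else 0.
have ar y : 0 < f y -> a (rank y) = f y.
  move=> fy; rewrite /a; case: pselect => [h|]; last by case; exists y.
  by case: cid2 => z fz /= /(rank_inj fz fy) ->.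
have a0 i : 0 <= a i by rewrite /a; case: pselect.
have aex i : 0 < a i -> exists2 y, 0 < f y & rank y = i.
  by rewrite /a; case: pselect => //; rewrite ltxx.
exists a, rank; split=> // i.
have := a0 i.+1; rewrite le_eqVlt => /predU1P[<-//|/aex[z fz zi]].
have [|y [yz fy yi]] := @rank_below z i fz; first by rewrite zi.
rewrite -zi -yi !ar//; move: yz; rewrite /prec => /orP[/ltW//|/andP[/eqP -> _]//].
Qed.

End DecreasingRearrangement.

Lemma freq_sum_le1 (R : realType) (I : eqType) (s : seq I) (U : I -> nat -> Prop) n :
  (forall j, (\sum_(i <- s) `[< U i j >] <= 1)%N) ->
  \sum_(i <- s) freq R (U i) n <= 1.
Proof.
move=> U1; rewrite -mulr_suml -natr_sum /count_below exchange_big /=.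
case: n => [|n]; first by rewrite invr0 mulr0.
rewrite ler_pdivrMr// mul1r ler_nat -[leqRHS](card_ord n.+1) -sum1_card.
exact: leq_sum.
Qed.

Lemma freq_sum_ge1 (R : realType) (I : eqType) (s : seq I) (U : I -> nat -> Prop) n :
  (0 < n)%N -> (forall j, (1 <= \sum_(i <- s) `[< U i j >])%N) ->
  1 <= \sum_(i <- s) freq R (U i) n.
Proof.
move=> n0 U1; rewrite -mulr_suml -natr_sum /count_below exchange_big /=.
rewrite ler_pdivlMr ?ltr0n// mul1r ler_nat -[leqLHS](card_ord n) -sum1_card.
exact: leq_sum.
Qed.

Lemma sum_label_le1 (xi : nat -> nat) n j : (\sum_(i < n) `[< xi j = i >] <= 1)%N.
Proof.
have [xn|xn] := ltnP (xi j) n; last first.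
  rewrite big1// => i _; apply/eqP; rewrite eqb0; apply/asboolPn => xi'.
  by move: (ltn_ord i); rewrite -xi' ltnNge xn.
rewrite (bigD1 (Ordinal xn))//= big1 ?addn0 ?leq_b1// => i /eqP ix.
by apply/eqP; rewrite eqb0; apply/asboolPn => xi'; apply: ix; exact: val_inj.
Qed.

Lemma cvg_sumr (R : realType) (I : Type) (s : seq I) (u : I -> nat -> R) (l : I -> R) :
  (forall i, u i n @[n --> \oo] --> l i) ->
  \sum_(i <- s) u i n @[n --> \oo] --> \sum_(i <- s) l i.
Proof. by move=> ul; apply: cvg_big => //; exact: add_continuous. Qed.

Lemma cvg_prodr (R : realType) (I : Type) (s : seq I) (u : I -> nat -> R) (l : I -> R) :
  (forall i, u i n @[n --> \oo] --> l i) ->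
  \prod_(i <- s) u i n @[n --> \oo] --> \prod_(i <- s) l i.
Proof. by move=> ul; apply: cvg_big => //; exact: mul_continuous. Qed.

Section Typical.
Variable R : realType.

Record typical (H : BorelSub FinN) : Prop := Typical {
  typical_cvg : forall x, cvgn (freq R (orb H x));
  typical_dust : forall x y, x <> y -> ~ (orb H x y /\ dust R H x);
  typical_recurrent : forall g x, val H g ->
    forall N, exists2 y, (N <= y)%N & val H (g ^ swap x y)%g;
  typical_sparse : forall l, exists k N, forall n, (N <= n)%N ->
    freq R (sparse R k H) n <= l.+1%:R^-1 }.

Lemma ae_typical (nu : probability (BorelSub FinN) R) : is_IRS nu ->
  {ae nu, forall H, typical H}.
Proof.
move=> nuI; have [e eP] := FinN_enum.
have h1 := ae_foralln (ae_orb_freq_cvg nuI).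
have h2 : {ae nu, forall H, forall x y, x <> y -> ~ (orb H x y /\ dust R H x)}.
  apply: ae_foralln => x; apply: ae_foralln => y.
  have [<-|/eqP xy] := eqVneq x y; first exact: aeW.
  by apply: filterS (ae_dust_fixed nuI xy) => H.
have h3 : {ae nu, forall H : BorelSub FinN, forall n x, val H (e n) ->
    forall N, exists2 y, (N <= y)%N & val H (e n ^ swap x y)%g}.
  by apply: ae_foralln => n; apply: ae_foralln => x; exact: ae_recurrent.
have h4 := ae_sparse_negligible nuI.
apply: filterS (filterI (filterI h1 h2) (filterI h3 h4)) => H [[? ?] [h ?]].
by split=> // g x; have [n <-] := eP g; exact: h.
Qed.

Section Blocks.
Variable H : BorelSub FinN.
Hypothesis tH : typical H.

Let three_cycle x b : b <> x -> orb H b x ->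
  forall N, exists2 y, (N <= y)%N & val H (cyc x b y).
Proof.
move=> bx [g [Hg gb]] N; have [m gm] := FinN_bound g.
have [y Ny Hy] := typical_recurrent tH x Hg (maxn N (maxn m b.+1)).
have [N1 [N2 N3]] : (N <= y /\ m <= y /\ b < y)%N by lia.
exists y => //; rewrite -(cyc_of_conj gb bx (gm y N2)); last by lia.
by apply: SubM => //; exact: SubV.
Qed.

Let all_three_cycles x y z : x <> y -> y <> z -> x <> z ->
  orb H y x -> orb H z x -> val H (cyc x y z).
Proof.
move=> xy yz xz yx zx.
have [u uN Hu] := three_cycle xy (orb_sym yx) (maxn x (maxn y z)).+1.
have [v vN Hv] := three_cycle (nesym xz) zx u.+1.
rewrite -(@cyc_commutator y x z u v).
  by apply: SubM; [apply: SubM => //; apply: SubM => //|]; exact: SubV.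
by rewrite /= !inE; lia.
Qed.

Let rep_ex x : exists y, `[< orb H x y >].
Proof. by exists x; apply/asboolP; exact: orb_refl. Qed.

Let rep x := ex_minn (rep_ex x).

Let repP x : orb H x (rep x).
Proof. by rewrite /rep; case: ex_minnP => y /asboolP. Qed.

Let rep_le x y : orb H x y -> (rep x <= y)%N.
Proof. by move=> xy; rewrite /rep; case: ex_minnP => z _; apply; exact/asboolP. Qed.

Let rep_eq x y : rep x = rep y <-> orb H x y.
Proof.
split=> [xy|xy].
  by apply: orb_trans (repP x) _; rewrite xy; exact: orb_sym.
apply/eqP; rewrite eqn_leq; apply/andP; split; apply: rep_le.
  exact: orb_trans xy (repP y).
exact: orb_trans (orb_sym xy) (repP x).
Qed.

Let f y : R := limn (freq R (fun j => rep j = y)).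

Let fE x : f (rep x) = limn (freq R (orb H x)).
Proof.
rewrite /f (_ : (fun j => _) = orb H x)//; apply/funext => j.
by apply/propext; rewrite -rep_eq; split.
Qed.

Let f_cvg y : freq R (fun j => rep j = y) n @[n --> \oo] --> f y.
Proof.
have [[x <-]|noy] := pselect (exists x, rep x = y).
  rewrite fE (_ : (fun j => _) = orb H x); first exact: typical_cvg.
  by apply/funext => j; apply/propext; rewrite -rep_eq; split.
have c0 : freq R (fun j => rep j = y) n @[n --> \oo] --> (0 : R).
  by apply: (@freq_finite_cvg0 _ _ 0%N) => j _ jy; apply: noy; exists j.
by rewrite /f (cvg_lim _ c0).
Qed.

Let f_ge0 y : 0 <= f y.
Proof. by apply: limr_ge; [exact: f_cvg|apply: nearW => n; exact: freq_ge0]. Qed.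

Let sum_freq_le1 (xi : nat -> nat) (l : nat -> R) n :
  (forall i, freq R (fun j => xi j = i) m @[m --> \oo] --> l i) ->
  \sum_(i < n) l i <= 1.
Proof.
move=> cl.
have cs : \sum_(i < n) freq R (fun j => xi j = i) m @[m --> \oo] --> \sum_(i < n) l i.
  by apply: cvg_sumr => i; exact: cl.
apply: (cvgr_to_le cs); apply: nearW => m; apply: freq_sum_le1 => j.
exact: sum_label_le1.
Qed.

Let dustE x : dust R H x <-> f (rep x) = 0.
Proof.
rewrite fE; split=> [/dust_cvg/cvg_lim-> //|fx k].
have cx : freq R (orb H x) n @[n --> \oo] --> (0 : R).
  by rewrite -fx; exact: typical_cvg.
have k0 : (0 : R) < k.+1%:R^-1 by rewrite invr_gt0.
by have [N _ HN] := cvgr_lt _ cx _ k0; exists N => n /HN/ltW.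
Qed.

(** The blocks are labelled 1, 2, ... in decreasing order of frequency, and the
   fixed points of H get the label 0. The latter have the full remaining
   frequency because the blocks with large labels are jointly negligible. *)
Lemma typical_structure : exists (a : nat -> R) (aD : D01 a) (a1 : sum_le1 a)
    (A : sign_subgroup (pos_index a)) (xi : nat -> nat),
  val H =1 sign_preimage A xi /\
  forall i, freq R (fun j => xi j = i) n @[n --> \oo] --> weight a i.
Proof.
have f1 n : \sum_(y < n) f y <= 1 by exact: sum_freq_le1 f_cvg.
have [a [r [a0 aS ar r_inj aex]]] := decreasing_rearrangement f_ge0 f1.
pose xi x := if 0 < f (rep x) then (r (rep x)).+1 else 0%N.
have xi_a x i : xi x = i.+1 -> [/\ 0 < f (rep x), a i = f (rep x) & r (rep x) = i].
  by rewrite /xi; case: ifP => // fx [<-]; rewrite ar.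
have xiS i : freq R (fun j => xi j = i.+1) n @[n --> \oo] --> a i.
  have := a0 i; rewrite le_eqVlt => /predU1P[ai|/aex[y fy ry]].
    rewrite -ai; apply: (@freq_finite_cvg0 _ _ 0%N) => j _ /xi_a[fj aj _].
    by move: fj; rewrite -aj -ai ltxx.
  rewrite -ry ar// (_ : (fun j => _) = (fun j => rep j = y)); first exact: f_cvg.
  apply/funext => j; apply/propext; split=> [/xi_a[fj _ /(r_inj _ _ fj fy)//]|jy].
  by rewrite /xi jy fy.
have suma n : \sum_(i < n) a i <= 1.
  have cs : \sum_(i < n) freq R (fun j => xi j = i.+1) m @[m --> \oo] --> \sum_(i < n) a i.
    by apply: cvg_sumr => i; exact: xiS.
  apply: (cvgr_to_le cs); apply: nearW => m.
  apply: (@freq_sum_le1 _ 'I_n _ (fun i j => xi j = i.+1)) => j.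
  apply: leq_trans (sum_label_le1 (fun j => (xi j).-1) n j).
  apply: leq_sum => i _; case: asboolP => // xij.
  by case: asboolP => // -[]; rewrite xij.
have aD : D01 a.
  split=> // i; rewrite a0 /=; apply: le_trans (suma i.+1).
  by rewrite big_ord_recr/= lerDr sumr_ge0.
have a1 : sum_le1 a.
  rewrite /sum_le1; apply: lime_le.
    by apply: is_cvg_nneseries => k _ _; rewrite lee_fin.
  by apply: nearW => n; rewrite big_mkord sumEFin lee_fin.
exists a, aD, a1.
have xi_orb x y : xi x = xi y -> 0 < f (rep x) -> orb H x y.
  move=> xy fx; apply/rep_eq.
  have [fx' ax rx] : [/\ 0 < f (rep x), a (r (rep x)) = f (rep x) & True] by rewrite ar.
  have /xi_a[fy _ ry] : xi y = (r (rep x)).+1 by rewrite -xy /xi fx.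
  exact: r_inj.
have xi_pos x : pos_index a (xi x) <-> 0 < f (rep x).
  split; first by rewrite /pos_index /xi /=; case: ifP => // _ [].
  by move=> fx; rewrite /pos_index /= /xi fx/= ar.
have [||x y z xy yz xz xy' xz' /xi_pos fx|A AE] :=
    @sign_preimage_of_cycles (pos_index a) H xi.
- by move=> g n Hg; rewrite /xi (_ : rep (g n) = rep n)//; apply/rep_eq/orb_sym; exists g.
- move=> g n Hg /xi_pos fn; apply: contrapT => gn.
  apply: (typical_dust tH (nesym gn)); split; first by exists g.
  by apply/dustE/eqP; rewrite eq_le f_ge0 leNgt andbT; exact/negP.
- by apply: all_three_cycles => //; apply/orb_sym/xi_orb.
exists A, xi; split=> // -[|i]; last exact: xiS.
have acv := alpha_series_cvg aD a1.
set w0 := weight a 0%N in acv *.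
apply/cvgrPdist_le => e e0.
have e3 : 0 < e / 3 by rewrite divr_gt0.
pose l := Num.truncn (e / 3)^-1.
have le3 : l.+1%:R^-1 <= e / 3.
  by rewrite -[leRHS]invrK lef_pV2 ?posrE ?invr_gt0//; apply/ltW/truncnS_gt.
have [k [N HN]] := typical_sparse tH l.
have [L1 _ HL1] : \forall L \near \oo, `|1 - w0 - series a L| <= e / 3.
  by move/cvgrPdist_le : acv; exact.
have [L2 _ HL2] : \forall L \near \oo, a L < k.+1%:R^-1.
  apply: (cvgr_lt (0 : R)); last by rewrite invr_gt0.
  exact: cvg_series_cvg_0 (cvgP _ acv).
pose L := maxn L1 L2.
have cs : \sum_(i < L) freq R (fun j => xi j = i.+1) m @[m --> \oo] --> \sum_(i < L) a i.
  by apply: cvg_sumr => i; exact: xiS.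
have [M _ HM] : \forall m \near \oo,
    `|\sum_(i < L) a i - \sum_(i < L) freq R (fun j => xi j = i.+1) m| <= e / 3.
  by move/cvgrPdist_le : cs; exact.
exists (maxn 1 (maxn N M)) => // n /=; rewrite !geq_max => /and3P[n0 Nn Mn].
have up : freq R (fun j => xi j = 0%N) n + \sum_(i < L) freq R (fun j => xi j = i.+1) n <= 1.
  rewrite -(big_ord_recl L (fun i : 'I_L.+1 => freq R (fun j => xi j = i) n)) /=.
  by apply: freq_sum_le1 => j; exact: sum_label_le1.
have lo : 1 <= freq R (sparse R k H) n + (freq R (fun j => xi j = 0%N) n +
    \sum_(i < L) freq R (fun j => xi j = i.+1) n).
  pose U (i : option 'I_L.+1) j := if i is Some i' then xi j = i' else sparse R k H j.
  have := @freq_sum_ge1 R (option 'I_L.+1) (None :: map Some (index_enum 'I_L.+1)) U n n0.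
  rewrite !big_cons !big_map /= big_ord_recl /=; apply => j.
  rewrite big_cons big_map.
  have [jL|jL] := ltnP (xi j) L.+1.
    by apply: leq_trans (leq_addl _ _); rewrite (bigD1 (Ordinal jL))//= asboolT// leq_addr.
  rewrite asboolT ?leq_addr//.
  case E : (xi j) jL => [//|i] jL; have [fj ai _] := xi_a _ _ E.
  have iL : (L2 <= i)%N by move: jL; rewrite ltnS /L; lia.
  have ak := HL2 i iL; split; last by move/dustE => fj0; rewrite fj0 ltxx in fj.
  rewrite ai fE in ak; have [K _ HK] := cvgr_lt _ (@typical_cvg _ tH j) _ ak.
  by exists K => m Km; apply/ltW/HK.
have sp := HN n Nn; have := HM n Mn.
have := HL1 L (leq_maxl _ _); rewrite /series /= big_mkord.
move: up lo sp le3; move: (freq R (sparse R k H) n) => p.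
move: (\sum_(i < L) freq R _ n) (freq R _ n) (\sum_(i < L) a i) (l.+1%:R^-1) => S b Sa v.
by rewrite !ler_norml => ? ? ? ? /andP[? ?] /andP[? ?]; apply/andP; split; lra.
Qed.

End Blocks.
End Typical.

(** * Events depending on finitely many labels *)

Section Patterns.
Variable m : nat.

(** The default value 0 beyond m is never seen by a local event. *)
Definition lab L (k : {ffun 'I_m -> 'I_L}) (i : nat) : nat :=
  if insub i is Some i' then k i' else 0%N.

Lemma labE L (k : {ffun 'I_m -> 'I_L}) (i : 'I_m) : lab k i = k i.
Proof. by rewrite /lab valK. Qed.

Definition local (S : (nat -> nat) -> bool) :=
  forall xi xi', (forall i, (i < m)%N -> xi i = xi' i) -> S xi = S xi'.

Variable R : realType.
Implicit Types (S : (nat -> nat) -> bool) (b w : nat -> R).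

Lemma localC S : local S -> local (predC S).
Proof. by move=> lS xi xi' /lS /= ->. Qed.

Definition pattern_sum S L b : R :=
  \sum_(k : {ffun 'I_m -> 'I_L} | S (lab k)) \prod_(i < m) b (k i).

Lemma pattern_sumC S L b :
  pattern_sum S L b + pattern_sum (predC S) L b = (\sum_(i < L) b i) ^+ m.
Proof.
rewrite /pattern_sum -(bigID (fun k => S (lab k)) xpredT) /=.
by rewrite -(bigA_distr_bigA (fun _ j => b (nat_of_ord j))) prodr_const card_ord.
Qed.

Lemma pattern_at_most_one S L (zeta : nat -> nat) : local S ->
  \sum_(k : {ffun 'I_m -> 'I_L} | S (lab k)) [forall i, zeta (nat_of_ord i) == k i]%:R
    <= (S zeta)%:R :> R.
Proof.
move=> lS; have [[k zk]|nok] := pselect (exists k : {ffun 'I_m -> 'I_L},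
    forall i : 'I_m, zeta i = k i); last first.
  rewrite big1// => k _; case: forallP => // h.
  by exfalso; apply: nok; exists k => i; exact/eqP.
have Sk : S (lab k) = S zeta.
  by apply: lS => i im; exact: etrans (labE k (Ordinal im)) (esym (zk (Ordinal im))).
have uk (k' : {ffun 'I_m -> 'I_L}) : [forall i, zeta (nat_of_ord i) == k' i] = (k' == k).
  apply/forallP/eqP => [h|-> i]; last by rewrite zk.
  by apply/ffunP => i; apply: val_inj; rewrite /= -zk; apply/esym/eqP/h.
rewrite -Sk big_mkcond (bigD1 k)//= big1 ?addr0.
  by case: (S _); rewrite // uk eqxx.
by move=> k' /negbTE kk'; rewrite uk kk'; case: (S _).
Qed.

(** The probability that a pattern sampled from the first n values of xi,
   uniformly and with replacement, satisfies S. *)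
Definition sample (xi : nat -> nat) S n : R :=
  (\sum_(t : {ffun 'I_m -> 'I_n}) (S (xi \o lab t))%:R) / n%:R ^+ m.

Lemma sampleC xi S n : (0 < n)%N -> sample xi S n + sample xi (predC S) n = 1.
Proof.
move=> n0; rewrite /sample -mulrDl -big_split /=.
rewrite (eq_bigr (fun=> 1)); last by move=> t _; case: (S _); rewrite /= ?addr0 ?add0r.
rewrite sumr_const card_ffun !card_ord -natrX divff//.
by rewrite pnatr_eq0 expn_eq0 negb_and -lt0n n0.
Qed.

Lemma pattern_sum_le_sample xi S L n : local S ->
  pattern_sum S L (fun i => freq R (fun j => xi j = i) n) <= sample xi S n.
Proof.
move=> lS; rewrite /pattern_sum /sample mulr_suml.
have E (k : {ffun 'I_m -> 'I_L}) : \prod_(i < m) freq R (fun j => xi j = k i) n =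
    \sum_(t : {ffun 'I_m -> 'I_n}) [forall i, (xi \o lab t) (nat_of_ord i) == k i]%:R / n%:R ^+ m.
  rewrite -mulr_suml /freq big_split /= prodr_const card_ord exprVn; congr (_ / _).
  under eq_bigr do rewrite /count_below natr_sum.
  rewrite bigA_distr_bigA /=; apply: eq_bigr => t _.
  case: forallP => [h|h].
    rewrite big1// => i _; rewrite asboolT//.
    by move: (h i); rewrite /= labE => /eqP.
  apply/eqP; rewrite prodf_seq_eq0; apply/hasP.
  have [i ni] : exists i : 'I_m, ~ (xi (t i) = k i).
    apply: contrapT => /forallNP h'; apply: h => i; rewrite /= labE.
    by apply/eqP; exact: contrapT (h' i).
  by exists i; rewrite ?mem_index_enum//= asboolF.
rewrite (eq_bigr _ (fun k _ => E k)) exchange_big /=.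
apply: ler_sum => t _; rewrite -mulr_suml ler_wpM2r ?invr_ge0 ?exprn_ge0//.
exact: (@pattern_at_most_one S L (xi \o lab t) lS).
Qed.

Lemma cvg_pattern_sum S L (b : nat -> nat -> R) w :
  (forall i, b n i @[n --> \oo] --> w i) ->
  pattern_sum S L (b n) @[n --> \oo] --> pattern_sum S L w.
Proof.
move=> bw; rewrite /pattern_sum.
rewrite (_ : (fun n => _) = fun n => \sum_(k : {ffun 'I_m -> 'I_L})
    ((S (lab k))%:R * \prod_(i < m) b n (k i))); last first.
  apply/funext => n; rewrite big_mkcond; apply: eq_bigr => k _.
  by case: (S _); rewrite ?mul1r ?mul0r.
rewrite (_ : \sum_(k | _) _ = \sum_(k : {ffun 'I_m -> 'I_L})
    ((S (lab k))%:R * \prod_(i < m) w (k i))); last first.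
  by rewrite big_mkcond; apply: eq_bigr => k _; case: (S _); rewrite ?mul1r ?mul0r.
apply: cvg_sumr => k; apply: cvgMr; apply: cvg_prodr => i; exact: bw.
Qed.

Lemma sandwich (p : nat -> R) (v : R) (x y : nat -> nat -> R) (xl yl : nat -> R) :
  (forall L, \forall n \near \oo, x L n <= p n) ->
  (forall L, \forall n \near \oo, y L n <= 1 - p n) ->
  (forall L, x L n @[n --> \oo] --> xl L) ->
  (forall L, y L n @[n --> \oo] --> yl L) ->
  (forall L, xl L <= v) -> (forall L, yl L <= 1 - v) ->
  xl L + yl L @[L --> \oo] --> (1 : R) -> p n @[n --> \oo] --> v.
Proof.
move=> xp yp cx cy xv yv c1; apply/cvgrPdist_le => e e0.
have e4 : 0 < e / 4 by rewrite divr_gt0.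
have [L _ HL'] : \forall L \near \oo, `|1 - (xl L + yl L)| <= e / 4.
  by move/cvgrPdist_le : c1; exact.
have HL := HL' L (leqnn L) : `|1 - (xl L + yl L)| <= e / 4.
near=> n.
have h1 : x L n <= p n by near: n; exact: xp.
have h2 : y L n <= 1 - p n by near: n; exact: yp.
have h3 : `|xl L - x L n| <= e / 4 by near: n; move: (cx L) => /cvgrPdist_le; exact.
have h4 : `|yl L - y L n| <= e / 4 by near: n; move: (cy L) => /cvgrPdist_le; exact.
have := xv L; have := yv L; move: HL h1 h2 h3 h4; rewrite !ler_norml.
move=> /andP[? ?] ? ? /andP[? ?] /andP[? ?] ? ?.
by apply/andP; split; lra.
Unshelve. all: by end_near. Qed.

Lemma cvg_pattern_total w : series w @ \oo --> (1 : R) ->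
  (\sum_(i < L) w i) ^+ m @[L --> \oo] --> (1 : R).
Proof.
move=> w1; have -> : 1 = \prod_(i < m) 1 :> R by rewrite big1.
rewrite (_ : (fun L => _) = fun L => \prod_(i < m) series w L).
  by apply: cvg_prodr => _.
by apply/funext => L; rewrite prodr_const card_ord /series /= big_mkord.
Qed.

Section ProductMeasure.
Variables (w : nat -> R) (mu : probability seqNat R).
Hypothesis mu_w : is_product_measure w mu.
Hypothesis w1 : series w @ \oo --> (1 : R).

Let measurable_coord i c : measurable [set xi : seqNat | xi i = c].
Proof. by apply: sub_sigma_algebra; exists i, [set c]. Qed.

Let measurable_cylinder n k : measurable (cylinder n k).
Proof.
apply: measurable_forall => i; apply: measurable_imply; first exact: measurable_cstP.
exact: measurable_coord.
Qed.

Lemma measurable_local S : local S -> measurable [set xi : seqNat | S xi].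
Proof.
move=> lS; pose C (s : seq nat) : set seqNat :=
  if S (nth 0%N s) then cylinder m (nth 0%N s) else set0.
rewrite [X in measurable X](_ : _ = \bigcup_s C s).
  apply: countable_bigcupT_measurable; first exact: countableP.
  by move=> s; rewrite /C; case: (S _).
apply/seteqP; split=> xi /=.
  move=> Sxi; exists (mkseq xi m) => //.
  have E i : (i < m)%N -> nth 0%N (mkseq xi m) i = xi i by exact: nth_mkseq.
  by rewrite /C (lS _ _ E) Sxi => i /E.
by move=> [s _]; rewrite /C; case: ifP => // Ss Cs; rewrite (lS _ _ Cs).
Qed.

Lemma pattern_sum_le_measure S L : local S ->
  pattern_sum S L w <= fine (mu [set xi : seqNat | S xi]).
Proof.
move=> lS; have mS := measurable_local lS.
rewrite -lee_fin fineK ?fin_num_measure//.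
rewrite -[X in mu X]setIT -integral_indic// /pattern_sum big_mkcond.
pose c (k : {ffun 'I_m -> 'I_L}) : R := (S (lab k))%:R.
have [Ic] := @integral_comb _ _ _ mu _ (index_enum {ffun 'I_m -> 'I_L}) c
  (fun k => cylinder m (lab k)) (fun k => measurable_cylinder m (lab k)).
rewrite (eq_bigr (fun k => if S (lab k) then \prod_(i < m) w (k i) else 0)); last first.
  move=> k _; rewrite mu_w /= /c; case: (S _); rewrite ?mul0r// mul1r.
  by apply: eq_bigr => i _; rewrite labE.
move=> <-; apply: le_integral => //; first exact: integrable_indic.
move=> xi _; rewrite lee_fin.
have -> : \1_[set xi : seqNat | S xi] xi = (S xi)%:R :> R.
  by rewrite indicE; congr (_%:R); congr nat_of_bool; apply/idP/idP; rewrite inE.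
apply: le_trans (@pattern_at_most_one S L xi lS).
rewrite [leRHS]big_mkcond; apply: ler_sum => k _; rewrite /c.
case: (S _); rewrite ?mul0r// mul1r indicE ler_nat.
case: (boolP (xi \in _)) => //; rewrite inE => Ck; rewrite lt0b.
by apply/forallP => i; rewrite -labE; apply/eqP/Ck.
Qed.

Let fine_setC S : local S ->
  fine (mu [set xi : seqNat | predC S xi]) = 1 - fine (mu [set xi : seqNat | S xi]).
Proof.
move=> lS; have mS := measurable_local lS.
have := probability_setC mu mS.
rewrite (_ : ~` _ = [set xi : seqNat | predC S xi]); last by apply/seteqP; split=> xi /= /negP.
by move=> ->; rewrite fineB ?fin_num_measure.
Qed.

Let measure_sandwich S (p : nat -> R) (x y : nat -> nat -> R) : local S ->
  (forall L, \forall n \near \oo, x L n <= p n) ->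
  (forall L, \forall n \near \oo, y L n <= 1 - p n) ->
  (forall L, x L n @[n --> \oo] --> pattern_sum S L w) ->
  (forall L, y L n @[n --> \oo] --> pattern_sum (predC S) L w) ->
  p n @[n --> \oo] --> fine (mu [set xi : seqNat | S xi]).
Proof.
move=> lS xp yp cx cy; apply: (sandwich xp yp cx cy).
- by move=> L; exact: pattern_sum_le_measure.
- by move=> L; rewrite -fine_setC//; apply: pattern_sum_le_measure; exact: localC.
- rewrite (_ : (fun L => _) = fun L => (\sum_(i < L) w i) ^+ m).
    exact: cvg_pattern_total.
  by apply/funext => L; exact: pattern_sumC.
Qed.

Lemma cvg_pattern_sum_measure S : local S ->
  pattern_sum S L w @[L --> \oo] --> fine (mu [set xi : seqNat | S xi]).
Proof.
move=> lS; set v := fine _.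
apply: (@squeeze_cvgr _ _ _ _ (fun L => v - (1 - (\sum_(i < L) w i) ^+ m)) (fun=> v)).
- apply: nearW => L; rewrite pattern_sum_le_measure// andbT.
  have := pattern_sum_le_measure L (localC lS); rewrite fine_setC// -/v.
  by have := pattern_sumC S L w; lra.
- have c1 : (\sum_(i < L) w i) ^+ m @[L --> \oo] --> (1 : R) by exact: cvg_pattern_total.
  have : v - (1 - (\sum_(i < L) w i) ^+ m) @[L --> \oo] --> v - (1 - 1).
    by apply: cvgB; [exact: cvg_cst|apply: cvgB => //; exact: cvg_cst].
  by rewrite subrr subr0.
- exact: cvg_cst.
Qed.

(** Both the sampling probability and the product measure are bounded below by
   the sums over patterns with labels below L, for the event and for its
   complement; these finite sums converge, and they leave no gap as L grows. *)
Lemma cvg_sample S xi : local S ->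
  (forall i, freq R (fun j => xi j = i) n @[n --> \oo] --> w i) ->
  sample xi S n @[n --> \oo] --> fine (mu [set xi : seqNat | S xi]).
Proof.
move=> lS xiw; apply: (@measure_sandwich S _
  (fun L n => pattern_sum S L (fun i => freq R (fun j => xi j = i) n))
  (fun L n => pattern_sum (predC S) L (fun i => freq R (fun j => xi j = i) n))) => //.
- by move=> L; apply: nearW => n; exact: pattern_sum_le_sample.
- move=> L; exists 1%N => // n /= n0; rewrite -(sampleC xi S n0) addrC addKr.
  by apply: pattern_sum_le_sample; exact: localC.
- by move=> L; exact: cvg_pattern_sum.
- by move=> L; exact: cvg_pattern_sum.
Qed.

Lemma measure_rectangle (h : nat -> pred nat) (W : nat -> R) :
  (forall l, \sum_(c < L) (h l c)%:R * w c @[L --> \oo] --> W l) ->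
  fine (mu [set xi : seqNat | [forall l : 'I_m, h l (xi l)]]) = \prod_(l < m) W l.
Proof.
move=> hW; pose S (xi : nat -> nat) := [forall l : 'I_m, h l (xi l)].
have lS : local S.
  by move=> xi xi' xiE; apply/eq_forallb => l; rewrite xiE.
apply/esym/(cvg_unique _ _ (cvg_pattern_sum_measure lS)) => //.
rewrite (_ : (fun L => _) = fun L => \prod_(l < m) \sum_(c < L) (h l c)%:R * w c).
  exact: cvg_prodr.
apply/funext => L; rewrite bigA_distr_bigA /= /pattern_sum big_mkcond.
apply: eq_bigr => k _; rewrite big_split /= /S.
case: forallP => [hk|/existsNP[l /negP hl]].
  by rewrite [X in X * _]big1 ?mul1r// => l _; move: (hk l); rewrite labE => ->.
rewrite [X in X * _](bigD1 l)//= -labE (negbTE hl) !mul0r//.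
Qed.

End ProductMeasure.
End Patterns.

(** * The law of the model subgroups *)

Lemma freq_card (R : realType) (xi : nat -> nat) i n :
  #|[pred j : 'I_n | xi j == i]|%:R / n%:R = freq R (fun j => xi j = i) n.
Proof.
rewrite /freq /count_below -sum1_card big_mkcond; congr (_%:R / _).
apply: eq_bigr => j _; rewrite inE; case: eqP => xij; first by rewrite asboolT.
by rewrite asboolF.
Qed.

Lemma measurable_freq_cvg d (T : measurableType d) (R : realType) (U : nat -> T -> Prop) (l : R) :
  (forall j, measurable [set x | U j x]) ->
  measurable [set x | freq R (fun j => U j x) n @[n --> \oo] --> l].
Proof.
move=> mU; rewrite [X in measurable X](_ : _ = [set x | forall k, exists N, forall n,
    (N <= n)%N -> `|l - freq R (fun j => U j x) n| <= k.+1%:R^-1]).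
  apply: measurable_forall => k; apply: measurable_exists => N; apply: measurable_forall => n.
  apply: measurable_imply; first exact: measurable_cstP.
  have mf := @measurable_freq _ T R (fun j => [set x | U j x]) n mU.
  rewrite [X in measurable X](_ : _ = setT `&` (fun x => freq R (fun j => U j x) n) @^-1`
      `[l - k.+1%:R^-1, l + k.+1%:R^-1]%classic); first exact: mf.
  by rewrite setTI; apply/seteqP; split=> x /=; rewrite in_itv/= -ler_distl distrC.
apply/seteqP; split=> x /=.
  move=> /cvgrPdist_le h k.
  have [|N _ HN] := h k.+1%:R^-1; first by rewrite invr_gt0.
  by exists N.
move=> h; apply/cvgrPdist_le => e e0; have [N HN] := h (Num.truncn e^-1).
exists N => // n /HN /le_trans; apply.
by rewrite -[leRHS]invrK lef_pV2 ?posrE ?invr_gt0//; apply/ltW/truncnS_gt.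
Qed.

Lemma probability_ae_eq d (T : measurableType d) (R : realType) (P : probability T R)
    (A B C : set T) : measurable A -> measurable B -> measurable C -> P (~` C) = 0%E ->
  A `&` C = B `&` C -> P A = P B.
Proof.
move=> mA mB mC C0 AB.
have PC X : measurable X -> P X = P (X `&` C).
  move=> mX; have mXC : measurable (X `&` C) by exact: measurableI.
  have mC' : measurable (~` C) by exact: measurableC.
  apply/eqP; rewrite eq_le; apply/andP; split; last first.
    by apply: le_measure; rewrite ?inE.
  apply: (@le_trans _ _ (P ((X `&` C) `|` ~` C))).
    apply: le_measure; rewrite ?inE//; first exact: measurableU.
    by move=> x Xx; have [Cx|Cx] := pselect (C x); [left|right].
  apply: (le_trans (measureU2 P mXC mC')).
  by rewrite [X in (_ + X <= _)%E]C0 adde0.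
by rewrite (PC A mA) AB -PC.
Qed.

Section Model.
Variables (R : realType) (a : nat -> R) (aD : D01 a) (a1 : sum_le1 a).
Let mu := mu_alpha aD a1.
Let w := weight a.

Let mu_w : is_product_measure w mu. Proof. exact: mu_alphaP. Qed.
Let w1 : series w @ \oo --> (1 : R). Proof. exact: weight_sum1. Qed.
Let w0 i : 0 <= w i. Proof. exact: weight_ge0. Qed.

Let measurable_coord i c : measurable [set xi : seqNat | xi i = c].
Proof. by apply: sub_sigma_algebra; exists i, [set c]. Qed.

Let measure_label (s : seq nat) (i : nat) : uniq s ->
  fine (mu [set xi : seqNat | forall j, j \in s -> xi j = i]) = \prod_(j <- s) w i.
Proof.
move=> us; pose m := (\max_(j <- s) j).+1.
have sm j : j \in s -> (j < m)%N by move=> js; rewrite ltnS (big_rem j)//= leq_maxl.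
pose h (l c : nat) := (l \in s) ==> (c == i).
pose W (l : nat) := if l \in s then w i else 1.
have cw (l : nat) : \sum_(c < L) (h l c)%:R * w c @[L --> \oo] --> W l.
  rewrite /h /W; case: (l \in s) => /=; last first.
    rewrite (_ : (fun L => _) = series w)//; apply/funext => L.
    by rewrite /series /= big_mkord; apply: eq_bigr => c _; rewrite mul1r.
  apply: cvg_near_cst; exists i.+1 => // L /= iL.
  rewrite (bigD1 (Ordinal iL))//= eqxx mul1r big1 ?addr0// => c ci.
  by rewrite (_ : (nat_of_ord c == i) = false) ?mul0r//; apply/negbTE.
have := @measure_rectangle m R w mu mu_w w1 h W cw.
rewrite (_ : [set xi : seqNat | [forall l : 'I_m, h l (xi l)]] =
    [set xi : seqNat | forall j, j \in s -> xi j = i]); last first.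
  apply/seteqP; split=> xi /=.
    by move=> /forallP hx j js; have := hx (Ordinal (sm j js)); rewrite /h /= js => /eqP.
  by move=> hx; apply/forallP => l; apply/implyP => ls; apply/eqP/hx.
move=> ->; rewrite /W -big_mkcond -(big_mkord (fun l => l \in s) (fun=> w i)) -big_filter.
apply: perm_big; apply: uniq_perm => //; first by rewrite filter_uniq// iota_uniq.
move=> j; rewrite mem_filter mem_index_iota /=.
by case: (boolP (j \in s)) => // /sm ->.
Qed.

Let measure_label1 i j : mu [set xi : seqNat | xi j = i] = (w i)%:E.
Proof.
rewrite -[LHS]fineK ?fin_num_measure//.
have := @measure_label [:: j] i isT; rewrite big_seq1 => <-.
congr ((fine (mu _))%:E); apply/seteqP; split=> xi /=; last by apply; rewrite inE.
by move=> xij k; rewrite inE => /eqP ->.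
Qed.

Let measure_label2 i j k : j <> k ->
  mu ([set xi : seqNat | xi j = i] `&` [set xi : seqNat | xi k = i]) = (w i ^+ 2)%:E.
Proof.
move=> /eqP jk; rewrite -[LHS]fineK ?fin_num_measure//; last exact: measurableI.
have := @measure_label [:: j; k] i; rewrite /= inE jk => /(_ isT).
rewrite big_cons big_seq1 -expr2 => <-.
congr ((fine (mu _))%:E); apply/seteqP; split=> xi /=.
  by move=> [xj xk] l; rewrite !inE => /orP[/eqP->|/eqP->].
by move=> h; split; apply: h; rewrite !inE eqxx ?orbT.
Qed.

(** This form of genericity is visibly measurable. *)
Let genericE (xi : seqNat) : generic a xi <-> forall i,
  freq R (fun j => xi j = i) n @[n --> \oo] --> w i /\ (w i = 0 -> forall j, xi j <> i).
Proof.
split=> h i; have := h i.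
  move=> hi; have [ne_pos _] := hi 1%N 0%N; have [pos_cvg _] := hi 0%N 3%N.
  have := w0 i; rewrite le_eqVlt => /predU1P[wi|wi].
    have xi0 j : xi j <> i.
      by move=> xij; have := ne_pos (ex_intro _ j xij); rewrite /= -/w -wi ltxx.
    split=> //; rewrite -wi; apply: (@freq_finite_cvg0 _ _ 0%N) => j _; exact: xi0.
  split=> [|wi0]; last by rewrite wi0 ltxx in wi.
  have [cf _] := pos_cvg wi; move: cf => /=.
  by under eq_fun do rewrite freq_card.
move=> [cf wi0]; have [wi|wi] := ltP 0 (w i); last first.
  have wE : w i = 0 by apply/eqP; rewrite eq_le wi w0.
  have noi j : xi j <> i by exact: wi0.
  tfae.
  - by [].
  - by move=> [j /noi].
  - move=> inf; exfalso; apply: inf; rewrite (_ : block xi i = set0)//.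
    by rewrite -subset0 => j /noi.
  - by case.
have inf : infinite_set (block xi i).
  move=> /finite_seqP[s sE].
  have c0 : freq R (fun j => xi j = i) n @[n --> \oo] --> (0 : R).
    apply: (@freq_finite_cvg0 _ _ (\max_(k <- s) k).+1) => j sj xij.
    have : block xi i j by [].
    rewrite sE /= => js; move: sj; rewrite ltnNge (big_rem j) //= leq_maxl //.
  by have := cvg_unique _ cf c0 => /(_ _) wE; move: wi; rewrite wE// ltxx.
tfae.
- move=> _; by have /set0P := infinite_setN0 inf; rewrite -/(block xi i) => /set0P.
- by [].
- by move=> _; split=> //; under eq_fun do rewrite freq_card.
- by [].
Qed.

Let measurable_generic : measurable [set xi : seqNat | generic a xi].
Proof.
rewrite [X in measurable X](_ : _ = [set xi : seqNat | forall i,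
  freq R (fun j => xi j = i) n @[n --> \oo] --> w i /\ (w i = 0 -> forall j, xi j <> i)]).
  apply: measurable_forall => i; apply: measurable_both.
    exact: (measurable_freq_cvg (w i) (fun j => measurable_coord j i)).
  apply: measurable_imply; first exact: measurable_cstP.
  by apply: measurable_forall => j; apply: measurable_not; exact: measurable_coord.
by apply/seteqP; split=> xi /= /genericE.
Qed.

Let ae_generic : mu (~` [set xi : seqNat | generic a xi]) = 0%E.
Proof.
suff [N [mN N0 NS]] : {ae mu, forall xi : seqNat, generic a xi}.
  apply/eqP; rewrite eq_le measure_ge0 andbT -[leRHS]N0.
  by apply: le_measure; rewrite ?inE//; exact: measurableC.
suff : {ae mu, forall xi : seqNat, forall i,
  freq R (fun j => xi j = i) n @[n --> \oo] --> w i /\ (w i = 0 -> forall j, xi j <> i)}.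
  by apply: filterS => xi /genericE.
apply: ae_foralln => i.
have h1 : {ae mu, forall xi : seqNat, freq R (fun j => xi j = i) n @[n --> \oo] --> w i}.
  apply: (@independent_freq_cvg _ _ _ mu (fun j => [set xi : seqNat | xi j = i]) (w i)
    (w i ^+ 2)) => //.
  by move=> j k; exact: measure_label2.
have h2 : {ae mu, forall xi : seqNat, w i = 0 -> forall j, xi j <> i}.
  have [wi|wi] := pselect (w i = 0); last exact: aeW.
  have : {ae mu, forall xi : seqNat, forall j, xi j <> i}.
    apply: ae_foralln => j; exists [set xi : seqNat | xi j = i]; split=> //.
      by have := measure_label1 i j; rewrite wi.
    by move=> xi /= /contrapT.
  by apply: filterS.
by apply: filterS (filterI h1 h2) => xi [].
Qed.

Variable A : sign_subgroup (pos_index a).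

Lemma local_sign_preimage (F : seq FinN) m : {in F, forall f, fixes_above f m} ->
  local m (fun xi => all (sign_preimage A xi) F).
Proof.
move=> Fm xi xi' xiE; apply: eq_in_all => f /Fm fm.
exact: sign_preimage_local xiE fm.
Qed.

Lemma common_bound (F : seq FinN) : exists m, {in F, forall f, fixes_above f m}.
Proof.
elim: F => [|f F [m Fm]]; first by exists 0%N.
have [n fn] := FinN_bound f; exists (maxn n m) => g; rewrite inE => /predU1P[->|/Fm gm].
  exact: fixes_above_leq (leq_maxl n m) fn.
exact: fixes_above_leq (leq_maxr n m) gm.
Qed.

Let measurable_S F : measurable [set xi : seqNat | all (sign_preimage A xi) F].
Proof.
have [m Fm] := common_bound F.
exact: measurable_local (local_sign_preimage Fm).
Qed.

Let f_alpha_contains F : f_alpha A @^-1` contains F =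
  ([set xi : seqNat | generic a xi] `&` [set xi : seqNat | all (sign_preimage A xi) F]) `|`
  ([set xi : seqNat | ~ generic a xi] `&` [set xi : seqNat | all (fun g => g == 1%g) F]).
Proof.
apply/seteqP; split=> xi /=; rewrite /contains /f_alpha /=; case: asboolP => /= gx.
- by left.
- by right.
- by case=> [[]|[]].
- by case=> [[]|[]].
Qed.

Lemma measurable_f_alpha : measurable_fun setT (f_alpha A).
Proof.
apply: (@measurability _ _ seqNat (BorelSub FinN) setT (f_alpha A) contains_sets
  BorelSub_generated) => _ [_ [F _ <-] <-].
rewrite setTI f_alpha_contains; apply: measurableU; apply: measurableI => //.
- exact: measurableC measurable_generic.
- exact: measurable_cstP.
Qed.

Lemma mu_f_alpha F :
  mu (f_alpha A @^-1` contains F) = mu [set xi : seqNat | all (sign_preimage A xi) F].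
Proof.
apply: (@probability_ae_eq _ _ _ mu _ _ [set xi : seqNat | generic a xi]) => //.
- rewrite -[X in measurable X]setTI; apply: measurable_f_alpha => //.
  exact: measurable_contains.
- rewrite f_alpha_contains; apply/seteqP; split=> xi /=.
    by case=> -[] [].
  by case=> ? ?; split=> //; left.
Qed.

(** This reconciles the two branches in the definition of nu_alpha. *)
Lemma f_alpha_trivial : w 0%N = 1 -> f_alpha A = fun=> trivial_subgroup FinN.
Proof.
move=> w01; apply/funext => xi; rewrite /f_alpha; case: asboolP => // gx.
have noI i : ~ pos_index a i.
  case: i => [[]//|i [_ wi]].
  have acv := alpha_series_cvg aD a1; rewrite -/w w01 subrr in acv.
  have : a i <= 0.
    have ai0 j : 0 <= a j by case/andP: (aD.1 j).
    apply: (@le_trans _ _ (series a i.+1)).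
      by rewrite /series /= big_nat_recr//= lerDr sumr_ge0.
    rewrite -(cvg_lim _ acv)//; apply: nondecreasing_cvgn_le; last exact: cvgP acv.
    exact: nondecreasing_series.
  by rewrite leNgt wi.
apply: Sub_eq => g /=; apply/asboolP/eqP => [[tau [[_ t1 _] _ gt]]|->].
  by apply: FinN_ext => n; rewrite gt t1.
exists (fun=> 1%g); split=> //.
  by split=> //; rewrite (_ : [set _ | _] = set0)// -subset0 => i /=.
rewrite (_ : sign_map _ = fun=> 1); first exact: sign_one.
by apply/funext => i; exact: FinN_sgn1.
Qed.

End Model.

(** * Sampling from a typical subgroup *)

Lemma extend_injection m (k : nat -> nat) :
  (forall i j, (i < m)%N -> (j < m)%N -> k i = k j -> i = j) ->
  exists g : FinN, forall i, (i < m)%N -> g i = k i.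
Proof.
elim: m => [|m IHm] kinj; first by exists 1%g.
have [|g gk] := IHm; first by move=> i j im jm; apply: kinj; exact: ltnW.
exists (swap (g m) (k m) * g)%g => i; rewrite ltnS leq_eqVlt => /predU1P[->|im].
  by rewrite FinN_mulE swapL.
rewrite FinN_mulE swapD; first exact: gk.
- by move=> /FinN_inj im'; rewrite im' ltnn in im.
- rewrite gk// => /kinj; rewrite ltnS (ltnW im) ltnSn => /(_ isT isT) im'.
  by rewrite im' ltnn in im.
Qed.

Lemma conj_agree (r r' f : FinN) m : fixes_above f m ->
  (forall i, (i < m)%N -> r i = r' i) -> (f ^ r^-1 = f ^ r'^-1)%g.
Proof.
move=> fm rr'; have [h hE] : exists h : FinN, r' = (r * h)%g.
  by exists (r^-1 * r')%g; rewrite mulKVg.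
have hm i : (i < m)%N -> h i = i.
  by move=> im; apply: (@FinN_inj r); rewrite -FinN_mulE -hE rr'.
have fh : (f ^ h^-1 = f)%g.
  apply: FinN_ext => n; rewrite conjgE invgK 2!FinN_mulE.
  have [mn|nm] := leqP m n.
    have mh : (m <= h^-1%g n)%N.
      rewrite leqNgt; apply/negP => hn; have := hm _ hn; rewrite FinN_mulgV => nE.
      by move: hn; rewrite -nE ltnNge mn.
    by rewrite (fm _ mh) FinN_mulgV fm.
  by rewrite (FinN_invE (hm _ nm)) hm// fixes_above_lt.
by rewrite hE invgM conjgM fh.
Qed.

Lemma limsup_eventually (R : realType) (u v : nat -> R) :
  (\forall n \near \oo, u n = v n) -> limsup u = limsup v.
Proof.
move=> [N _ uv]; rewrite /limsup; congr fine; rewrite !limn_esup_lim.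
apply/esym/cvg_lim => //; apply: cvg_trans (@is_cvg_esups R (EFin \o u)).
apply: near_eq_cvg; exists N => // n /= Nn; rewrite /esups /=; congr ereal_sup.
by apply/seteqP; split=> _ [k /= nk <-]; exists k => //=; rewrite uv//=; exact: leq_trans nk.
Qed.

Section Copies.
Variables (R : realType) (F : seq FinN) (m : nat).
Hypothesis Fm : {in F, forall f, fixes_above f m}.

(** Any choice will do: conjugating an element supported below m only involves
   the values below m, see [conj_agree]. *)
Definition extension n (t : {ffun 'I_m -> 'I_n}) : FinN :=
  xget 1%g [set g : FinN | forall i : 'I_m, g i = t i :> nat].

Lemma extensionE n (t : {ffun 'I_m -> 'I_n}) (i : 'I_m) : injective t ->
  extension t i = t i :> nat.
Proof.
move=> tinj; rewrite /extension; case: xgetP => [g _ -> //|noext].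
have [|g gk] := @extend_injection m (lab t); last first.
  by exfalso; apply: (noext g) => j; rewrite gk// labE.
move=> j k jm km; rewrite (labE t (Ordinal jm)) (labE t (Ordinal km)).
by move=> /val_inj/tinj/(congr1 val).
Qed.

Definition copy_in n (t : {ffun 'I_m -> 'I_n}) (H : BorelSub FinN) : bool :=
  injectiveb t && all (fun f => val H (f ^ (extension t)^-1)%g) F.

(** The proportion is taken among all maps, injective or not, to be comparable
   with sampling with replacement. *)
Definition copies n (H : BorelSub FinN) : R :=
  (\sum_(t : {ffun 'I_m -> 'I_n}) (copy_in t H)%:R) / n%:R ^+ m.

Definition injections n : R := (n ^_ m)%:R / n%:R ^+ m.

Lemma cvg_injections : injections n @[n --> \oo] --> (1 : R).
Proof.
rewrite -(cvg_shiftS injections).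
rewrite (_ : (fun n => _) = fun n => \prod_(i < m) ((n.+1 - i)%:R / n.+1%:R)); last first.
  apply/funext => n; rewrite /injections ffact_prod big_split /= prodr_const card_ord exprVn.
  by rewrite natr_prod.
suff cp : \prod_(i < m) ((n.+1 - i)%:R / n.+1%:R) @[n --> \oo] --> \prod_(i < m) (1 : R).
  by rewrite big1 in cp.
apply: cvg_prodr => i.
have c1 : 1 - i%:R * n.+1%:R^-1 @[n --> \oo] --> (1 - i%:R * 0 : R).
  apply: cvgB; first exact: cvg_cst.
  by apply: cvgMr; exact: cvg_harmonic.
rewrite mulr0 subr0 in c1; apply: cvg_trans c1; apply: near_eq_cvg.
exists i => // n /= im; rewrite natrB ?(leq_trans im)//.
by rewrite mulrBl divff.
Qed.

Lemma copies_unit n : unit_valued (copies n).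
Proof.
move=> H; rewrite /copies mulr_ge0 ?sumr_ge0 ?invr_ge0 ?exprn_ge0//=.
have [n0|n0] := eqVneq (n%:R ^+ m : R) 0; first by rewrite n0 invr0 mulr0.
rewrite ler_pdivrMr ?mul1r ?lt0r ?n0 ?exprn_ge0//.
have -> : n%:R ^+ m = \sum_(t : {ffun 'I_m -> 'I_n}) 1 :> R.
  by rewrite sumr_const card_ffun !card_ord natrX.
by apply: ler_sum => t _; case: (copy_in _ _).
Qed.

Let measurable_copy n (t : {ffun 'I_m -> 'I_n}) : measurable [set H | copy_in t H].
Proof.
rewrite /copy_in; case: injectiveb => /=; last exact: measurable_cstP.
exact: (@measurable_all _ _ _ F (fun f (H : BorelSub FinN) => val H (f ^ (extension t)^-1)%g)
  (fun f => measurable_mem (f ^ (extension t)^-1)%g)).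
Qed.

Lemma copies_comb n H : copies n H =
  \sum_(t : {ffun 'I_m -> 'I_n}) (n%:R ^+ m)^-1 * \1_[set H | copy_in t H] H.
Proof.
rewrite /copies mulr_suml; apply: eq_bigr => t _; rewrite mulrC; congr (_ * _).
by rewrite indicE; congr (_%:R); congr nat_of_bool; apply/idP/idP; rewrite inE.
Qed.

Lemma measurable_copies n : measurable_fun setT (copies n).
Proof.
rewrite (_ : copies n = fun H =>
  \sum_(t : {ffun 'I_m -> 'I_n}) (n%:R ^+ m)^-1 * \1_[set H | copy_in t H] H).
  by apply: measurable_sum => t; apply: measurable_funM => //; exact: measurable_indic.
by apply/funext => H; exact: copies_comb.
Qed.

Lemma copies_conj (g : FinN) n H : fixes_above g n ->
  copies n (conj_subgroup g H) = copies n H.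
Proof.
move=> gn; have gVn := fixes_aboveV gn.
pose s (t : {ffun 'I_m -> 'I_n}) : {ffun 'I_m -> 'I_n} :=
  [ffun i => Defs.restr_perm gVn (t i)].
have sinj : injective s.
  move=> t t' /ffunP tt'; apply/ffunP => i; have := tt' i.
  by rewrite !ffunE; exact: perm_inj.
rewrite /copies [in RHS](reindex_inj sinj); congr (_ / _); apply: eq_bigr => t _.
congr (_%:R); congr nat_of_bool; rewrite /copy_in.
have -> : injectiveb (s t) = injectiveb t.
  apply/injectiveP/injectiveP => tinj i j.
    by move=> tij; apply: tinj; rewrite !ffunE tij.
  by rewrite !ffunE => /perm_inj; exact: tinj.
case: injectiveP => //= tinj; apply: eq_in_all => f /Fm fm /=.
have stinj : injective (s t) by move=> i j; rewrite !ffunE => /perm_inj; exact: tinj.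
rewrite -conjgM -[in LHS](invgK g) -invgM; congr (val H _).
apply: conj_agree fm _ => i im; rewrite FinN_mulE.
rewrite (extensionE (Ordinal im) tinj) (extensionE (Ordinal im) stinj).
by rewrite ffunE permE ord_restrE.
Qed.

Lemma integral_copies (nu : probability (BorelSub FinN) R) n : is_IRS nu ->
  (\int[nu]_H (copies n H)%:E = (fine (nu (contains F)) * injections n)%:E)%E.
Proof.
move=> nuI; under eq_integral do rewrite copies_comb.
have [_ ->] := @integral_comb _ _ _ nu _ (index_enum {ffun 'I_m -> 'I_n})
  (fun=> (n%:R ^+ m)^-1) (fun t => [set H | copy_in t H]) (@measurable_copy n).
rewrite -mulr_sumr /injections mulrA [RHS in _ = RHS%:E]mulrC; congr (_ * _)%:E.
rewrite (eq_bigr (fun t : {ffun 'I_m -> 'I_n} =>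
    if injectiveb t then fine (nu (contains F)) else 0)); last first.
  move=> t _; case: ifP => it; last first.
    by rewrite (_ : [set H | _] = set0) ?measure0// -subset0 => H; rewrite /copy_in /= it.
  congr fine; apply: (@IRS_conj _ nu nuI (extension t)^-1%g (fun H => contains F H)).
    exact: measurable_contains.
  by move=> H; rewrite /copy_in it.
rewrite -big_mkcond sumr_const -[LHS]mulr_natr; congr (_ * _%:R).
rewrite -[in RHS](card_ord n) -[in RHS](card_ord m) -card_inj_ffuns -sum1_card -sum1_card.
by apply: eq_bigl => t; rewrite inE.
Qed.

Lemma cvg_copies (H : BorelSub FinN) (I : set nat) (A : sign_subgroup I) xi (v : R) :
  val H =1 sign_preimage A xi ->
  sample m R xi (fun xi => all (sign_preimage A xi) F) n @[n --> \oo] --> v ->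
  copies n H @[n --> \oo] --> v.
Proof.
move=> HA cv; pose S xi := all (sign_preimage A xi) F.
have copyE n (t : {ffun 'I_m -> 'I_n}) : copy_in t H = injectiveb t && S (xi \o lab t).
  rewrite /copy_in; case: injectiveP => //= tinj; apply: eq_in_all => f /Fm fm.
  rewrite HA sign_preimage_conj; apply: sign_preimage_local fm => i im /=.
  by rewrite (extensionE (Ordinal im) tinj) (labE t (Ordinal im)).
apply: (@squeeze_cvgr _ _ _ _ (fun n => sample m R xi S n - (1 - injections n))
    (sample m R xi S)) => //.
- exists 1%N => // n /= n0; have nm0 : 0 < n%:R ^+ m :> R by rewrite exprn_gt0// ltr0n.
  rewrite /sample /copies /injections; apply/andP; split; last first.
    rewrite ler_pM2r ?invr_gt0//; apply: ler_sum => t _.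
    by rewrite copyE; case: injectiveb.
  rewrite lerBlDr -lerBlDl -mulrBl ler_pdivrMr// mulrBl divfK ?gt_eqF// mul1r.
  rewrite lerBrDr -sumrB.
  have -> : (n ^_ m)%:R = \sum_(t : {ffun 'I_m -> 'I_n}) (injectiveb t)%:R :> R.
    rewrite -natr_sum -[in LHS](card_ord n) -[in LHS](card_ord m) -card_inj_ffuns -sum1_card.
    by rewrite big_mkcond; congr (_%:R); apply: eq_bigr => t _; rewrite inE; case: injectiveb.
  have -> : n%:R ^+ m = \sum_(t : {ffun 'I_m -> 'I_n}) 1 :> R.
    by rewrite sumr_const card_ffun !card_ord natrX.
  rewrite -big_split /=; apply: ler_sum => t _; rewrite copyE.
  by case: injectiveb; case: (S _); rewrite /=; lra.
- rewrite -[X in _ --> X]subr0 -(subrr (1 : R)); apply: cvgB => //.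
  by apply: cvgB; [exact: cvg_cst|exact: cvg_injections].
Qed.

(** The limit of the proportions is invariant, hence constant, and
   its mean is the probability that H contains F. *)
Lemma ae_limsup_copies (nu : probability (BorelSub FinN) R) : is_IRS nu -> is_ergodic nu ->
  {ae nu, forall H, limsup (fun n => copies n H) = fine (nu (contains F))}.
Proof.
move=> nuI nuE; pose f H := limsup (fun n => copies n H).
have mf : measurable_fun setT f by exact: (measurable_limsup measurable_copies).
apply: ae_eq_mean => //.
- by move=> H; apply: limsup_unit => n; exact: copies_unit.
- apply: integral_limsup => //.
  + exact: measurable_copies.
  + exact: copies_unit.
  + apply: filterS (ae_typical nuI) => H /typical_structure[a [aD [a1 [A [xi [HA xia]]]]]].
    have := cvg_sample (mu_alphaP aD a1) (weight_sum1 aD a1)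
      (local_sign_preimage A Fm) xia.
    by move=> /(cvg_copies HA) /cvgP.
  + under eq_fun do rewrite integral_copies//.
    apply: cvg_EFin; first exact: nearW.
    rewrite -[X in _ --> X]mulr1; apply: cvgMr; exact: cvg_injections.
- apply: nuE.
    rewrite -[X in measurable X]setTI.
    exact: (@measurable_fun_ltr _ _ _ setT f (cst (fine (nu (contains F))))).
  move=> g; have fE H : f (conj_subgroup g H) = f H.
    apply: limsup_eventually; have [N gN] := FinN_bound g; exists N => // n /= Nn.
    by apply: copies_conj; exact: fixes_above_leq Nn gN.
  rewrite -/f; apply/seteqP; split=> H.
    by rewrite -[X in _ -> X]/(f H < _ : Prop) -fE.
  by rewrite -[X in X -> _]/(f H < _ : Prop) -fE.
Qed.

End Copies.

Lemma ae_exists d (T : measurableType d) (R : realType) (P : probability T R)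
    (Q : T -> Prop) : {ae P, forall x, Q x} -> exists x, Q x.
Proof.
move=> [N [mN N0 QN]]; apply: contrapT => /forallNP noQ.
have NT : N = setT by apply/seteqP; split=> // x _; exact: QN (noQ x).
have := probability_setT P; rewrite -NT N0 => /eqP.
by rewrite eq_sym onee_eq0.
Qed.

Theorem theorem1p1 (R : realType) (nu : probability (BorelSub FinN) R) :
  is_IRS nu -> is_ergodic nu ->
  exists (a : nat -> R) (aD : D01 a) (a1 : sum_le1 a)
         (A : sign_subgroup (pos_index a)),
    forall E : set (BorelSub FinN), measurable E -> nu E = nu_alpha aD a1 A E.
Proof.
move=> nuI nuE; have [e eP] := FinN_enum.
pose bound F := sval (cid (common_bound F)).
have boundP F : {in F, forall f, fixes_above f (bound F)} := svalP (cid (common_bound F)).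
pose L n : seq FinN := map e (odflt [::] (unpickle n)).
have LP F : exists n, L n = F.
  have /choice[c cE] := eP; exists (pickle (map c F)).
  by rewrite /L pickleK /= -map_comp (eq_map (g := id)) ?map_id.
have limL : {ae nu, forall H, forall n, limsup (fun k => copies R (L n) (bound (L n)) k H) =
    fine (nu (contains (L n)))}.
  by apply: ae_foralln => n; exact: (ae_limsup_copies (boundP (L n)) nuI nuE).
have [H [tH limH]] := ae_exists (filterI (ae_typical nuI) limL).
have [a [aD [a1 [A [xi [HA xia]]]]]] := typical_structure tH.
exists a, aD, a1, A.
pose mu := mu_alpha aD a1.
have nuF F : nu (contains F) = mu (f_alpha A @^-1` contains F).
  rewrite mu_f_alpha; have [n nF] := LP F.
  have mS : measurable [set xi : seqNat | all (sign_preimage A xi) F].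
    exact: measurable_local (local_sign_preimage A (boundP F)).
  rewrite -[LHS]fineK ?fin_num_measure//; last exact: measurable_contains.
  rewrite -[RHS]fineK ?fin_num_measure//; congr EFin.
  rewrite -nF -limH nF; apply: cvg_limsup; apply: (cvg_copies (boundP F) HA).
  exact: (cvg_sample (mu_alphaP aD a1) (weight_sum1 aD a1)
    (local_sign_preimage A (boundP F)) xia).
have nuE' E : measurable E -> nu E = mu (f_alpha A @^-1` E).
  pose X : {mfun seqNat >-> BorelSub FinN} :=
    HB.pack (f_alpha A : seqNat -> BorelSub FinN)
      (isMeasurableFun.Build _ _ seqNat (BorelSub FinN) (f_alpha A) (measurable_f_alpha aD a1 A)).
  apply: (@measure_unique _ R (BorelSub FinN) contains_sets (fun=> setT)
    BorelSub_generated contains_setI _ _ nu (distribution mu X)).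
  - by move=> _; exists [::] => //; apply/seteqP; split.
  - by rewrite bigcup_const.
  - by move=> _ [F _ <-]; exact: nuF.
  - by move=> _; rewrite ltey_eq fin_num_measure.
move=> E mE; rewrite nuE'// /nu_alpha; case: eqP => // w01.
rewrite (f_alpha_trivial aD a1 A w01) diracE.
have [Et|Et] := boolP (trivial_subgroup FinN \in E).
  rewrite (_ : _ @^-1` _ = setT) ?probability_setT//.
  by apply/seteqP; split=> // ? _; exact: set_mem.
rewrite (_ : _ @^-1` _ = set0) ?measure0//.
by rewrite -subset0 => ? /mem_set; exact/negP.
Qed.
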